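(* Let $a\in\mathbb D$, $b=-a$, and $z=(0,\gamma)$ with $|a|^2<|\gamma|\le|a|^{3/2}$. For $\varepsilon\in\mathbb C\setminus\{0\}$ let $L^\varepsilon_{aVbV}$ be Coman's Lempert function on $\mathbb D^2$ with the four poles $(a,0),(b,0),(b,\varepsilon),(a,\varepsilon)$, all of weight $1$. Then $$\limsup_{\varepsilon\to0}L^\varepsilon_{aVbV}(z)<\min\{L_{a0b0}(z),L_{aVb0}(z),L_{a0bV}(z),L_{aVbV}(z)\}.$$
   Context: $\mathbb D$ is the open unit disc; maps $\varphi=(\varphi_1,\varphi_2)$ are holomorphic $\mathbb D\to\mathbb D^2$, $\zeta_j\in\mathbb D$. Coman's Lempert function with poles $p_1,\dots,p_k$ of weight 1: $\inf\{\sum_j\log|\zeta_j|:\varphi(0)=z,\varphi(\zeta_j)=p_j\}$. All of the following are infima over $\varphi$ with $\varphi(0)=z$, $\varphi(\zeta_1)=(a,0)$, $\varphi(\zeta_2)=(b,0)$: $L_{a0b0}(z)=\inf(\log|\zeta_1|+\log|\zeta_2|)$; $L_{a0bV}(z)=\inf(\log|\zeta_1|+2\log|\zeta_2|)$ with additionally $\varphi_1'(\zeta_2)=0$; $L_{aVb0}(z)=\inf(2\log|\zeta_1|+\log|\zeta_2|)$ with additionally $\varphi_1'(\zeta_1)=0$; $L_{aVbV}(z)=\inf(2\log|\zeta_1|+2\log|\zeta_2|)$ with additionally $\varphi_1'(\zeta_1)=\varphi_1'(\zeta_2)=0$. *)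

(* Defs.v *)
From HB Require Import structures.
From mathcomp Require Import all_boot all_order all_algebra.
From mathcomp Require Import all_classical all_reals all_analysis.
From mathcomp Require Import complex.
Set Implicit Arguments. Unset Strict Implicit. Unset Printing Implicit Defensive.
Import Order.TTheory GRing.Theory Num.Theory.
Import numFieldNormedType.Exports.
Local Open Scope classical_set_scope.
Local Open Scope ring_scope.
Local Open Scope complex_scope.

Section Lempert.
Variable R : realType.
Local Notation C := (R[i])%C.

Definition cabs (z : C) : R := Normc.normc z.

Definition inD (z : C) : Prop := cabs z < 1.

Definition holD (f : C -> C) : Prop := forall z, inD z -> derivable (f : C^o -> C^o) (z : C^o) 1.

Definition holD2 (phi1 phi2 : C -> C) : Prop :=
  holD phi1 /\ holD phi2 /\ forall z, inD z -> inD (phi1 z) /\ inD (phi2 z).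

Definition elog (z : C) : \bar R :=
  if z == 0 then -oo%E else (ln (cabs z))%:E.

Definition coman (poles : seq (C * C)) (z : C * C) : \bar R :=
  ereal_inf [set x : \bar R | exists (phi1 phi2 : C -> C) (zs : seq C),
    size zs = size poles /\ holD2 phi1 phi2 /\ (forall w, w \in zs -> inD w) /\
    (phi1 0, phi2 0) = z /\
    (forall j, (j < size poles)%N ->
        (phi1 (nth 0 zs j), phi2 (nth 0 zs j)) = nth (0, 0) poles j) /\
    x = (\sum_(w <- zs) elog w)%E].

Definition L_a0b0 (a b : C) (z : C * C) : \bar R :=
  ereal_inf [set x : \bar R | exists (phi1 phi2 : C -> C) (z1 z2 : C),
    holD2 phi1 phi2 /\ inD z1 /\ inD z2 /\ (phi1 0, phi2 0) = z /\
    (phi1 z1, phi2 z1) = (a, 0) /\ (phi1 z2, phi2 z2) = (b, 0) /\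
    x = (elog z1 + elog z2)%E].

Definition L_a0bV (a b : C) (z : C * C) : \bar R :=
  ereal_inf [set x : \bar R | exists (phi1 phi2 : C -> C) (z1 z2 : C),
    holD2 phi1 phi2 /\ inD z1 /\ inD z2 /\ (phi1 0, phi2 0) = z /\
    (phi1 z1, phi2 z1) = (a, 0) /\ (phi1 z2, phi2 z2) = (b, 0) /\
    derive1 (phi1 : C -> C^o) z2 = 0 /\
    x = (elog z1 + 2%:E * elog z2)%E].

Definition L_aVb0 (a b : C) (z : C * C) : \bar R :=
  ereal_inf [set x : \bar R | exists (phi1 phi2 : C -> C) (z1 z2 : C),
    holD2 phi1 phi2 /\ inD z1 /\ inD z2 /\ (phi1 0, phi2 0) = z /\
    (phi1 z1, phi2 z1) = (a, 0) /\ (phi1 z2, phi2 z2) = (b, 0) /\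
    derive1 (phi1 : C -> C^o) z1 = 0 /\
    x = (2%:E * elog z1 + elog z2)%E].

Definition L_aVbV (a b : C) (z : C * C) : \bar R :=
  ereal_inf [set x : \bar R | exists (phi1 phi2 : C -> C) (z1 z2 : C),
    holD2 phi1 phi2 /\ inD z1 /\ inD z2 /\ (phi1 0, phi2 0) = z /\
    (phi1 z1, phi2 z1) = (a, 0) /\ (phi1 z2, phi2 z2) = (b, 0) /\
    derive1 (phi1 : C -> C^o) z1 = 0 /\ derive1 (phi1 : C -> C^o) z2 = 0 /\
    x = (2%:E * elog z1 + 2%:E * elog z2)%E].

Definition Leps_aVbV (a b eps : C) (z : C * C) : \bar R :=
  coman [:: (a, 0); (b, 0); (b, eps); (a, eps)] z.

Definition limsup0 (f : C -> \bar R) : \bar R :=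
  ereal_inf [set ereal_sup [set f e | e in [set e : C | e != 0 /\ cabs e < d]]
            | d in [set d : R | 0 < d]].

End Lempert.

(* Main.v *)
(** Put A = |a|. Under the hypotheses the limit superior is at most 2 log A, while the four other
    functions are bounded below by constants larger than 2 log A.

    Lower bounds. Two zeros of phi_2 give L_a0b0 >= log |gamma| > 2 log A. If phi_1 - a has a double
    zero at zeta_1, the Schwarz lemma gives A <= |zeta_1|^2, and A <= |zeta_2| always, so the other
    functions are at least 2 log A. Near-equality makes the quotient of the Moebius transform of phi_1
    by the squared Blaschke factor at zeta_1 almost constant; phi_1 is then almost a Blaschke product
    of degree 2 with its only critical point at zeta_1, which is incompatible both with
    |zeta_2| = A and with a second critical point at zeta_2.

    Upper bound. For P slightly larger than A, a perturbation of the Blaschke product of degree 2 with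
    critical value P has a fibre of two nearby points t, -t over a and a fibre w, -w over -a (in a
    suitable coordinate). The product of the moduli of these four points is close to P^2. A second
    component vanishing near t, w and -w is corrected by terms of order eps so that it vanishes at t, w
    and equals eps at -t, -w, where t is a multiple of eps. This requires |gamma| < P^(3/2).

    The Schwarz lemma is derived from Goursat's lemma: the integral of a holomorphic function over a circle is
    computed in logarithmic polar coordinates, which leads to Cauchy's formula, to the removability of
    isolated singularities and to the maximum principle. *)
Require Import Defs.
From HB Require Import structures.
From mathcomp Require Import all_boot all_order all_algebra.
From mathcomp Require Import all_classical all_reals all_analysis.
From mathcomp Require Import complex.
From mathcomp Require Import ring lra.
Set Implicit Arguments. Unset Strict Implicit. Unset Printing Implicit Defensive.
Import Order.TTheory GRing.Theory Num.Theory.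
Import numFieldNormedType.Exports.
Local Open Scope classical_set_scope.
Local Open Scope ring_scope.

(** * Bisection of rectangles and real primitives *)

(** If [P] failed on the whole rectangle, it would fail on a quarter of it, then on a quarter of
    that, and so on; these nested rectangles shrink to a point, where the local hypothesis gives a
    contradiction. The level [n] is an argument of [P] because it fixes the side lengths. *)
Lemma bisection_rect (R : realType) (P : nat -> R -> R -> Prop) (X Y H K : R) :
  0 < H -> 0 < K ->
  (forall n x y, let h := H / 2 ^+ n.+1 in let k := K / 2 ^+ n.+1 in
     P n.+1 x y -> P n.+1 (x + h) y -> P n.+1 x (y + k) -> P n.+1 (x + h) (y + k) -> P n x y) ->
  (forall x0 y0, X <= x0 <= X + H -> Y <= y0 <= Y + K -> exists2 d : R, 0 < d &
     forall n x y, let h := H / 2 ^+ n in let k := K / 2 ^+ n in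
     h < d -> k < d -> x <= x0 <= x + h -> y <= y0 <= y + k ->
     X <= x -> x + h <= X + H -> Y <= y -> y + k <= Y + K -> P n x y) ->
  P 0%N X Y.
Proof.
move=> H0 K0 sub loc; apply: contrapT => nP.
pose good n (p : R * R) := [/\ ~ P n p.1 p.2, X <= p.1, p.1 + H / 2 ^+ n <= X + H,
  Y <= p.2 & p.2 + K / 2 ^+ n <= Y + K].
have half (L : R) n : L / 2 ^+ n.+1 + L / 2 ^+ n.+1 = L / 2 ^+ n.
  by rewrite exprS; field.
have pos (L : R) n : 0 < L -> 0 < L / 2 ^+ n by move=> ?; rewrite divr_gt0 ?exprn_gt0.
have step n p : good n p -> exists q, [/\ good n.+1 q, p.1 <= q.1,
    q.1 + H / 2 ^+ n.+1 <= p.1 + H / 2 ^+ n, p.2 <= q.2 &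
    q.2 + K / 2 ^+ n.+1 <= p.2 + K / 2 ^+ n].
  case: p => x y [/= nPxy h1 h2 h3 h4].
  have hH := half H n; have hK := half K n.
  have pH := pos H n.+1 H0; have pK := pos K n.+1 K0.
  set h := H / 2 ^+ n.+1 in hH pH *; set k := K / 2 ^+ n.+1 in hK pK *.
  have [a|na] := pselect (P n.+1 x y); last first.
    by exists (x, y); rewrite /good /= -/h -/k; do !split => //; lra.
  have [b|nb] := pselect (P n.+1 (x + h) y); last first.
    by exists (x + h, y); rewrite /good /= -/h -/k; do !split => //; lra.
  have [c|nc] := pselect (P n.+1 x (y + k)); last first.
    by exists (x, y + k); rewrite /good /= -/h -/k; do !split => //; lra.
  have [e|ne] := pselect (P n.+1 (x + h) (y + k)); last first.
    by exists (x + h, y + k); rewrite /good /= -/h -/k; do !split => //; lra.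
  by case: nPxy; apply: sub.
(* The choice of the next corner needs a proof that the present one is good, so the recursion runs
   on sigma types. *)
pose T n := {p : R * R | good n p}.
have g0 : good 0%N (X, Y) by split => //=; rewrite expr0 divr1.
pose t0 : T 0%N := exist _ (X, Y) g0.
pose nxt n (t : T n) : T n.+1 :=
  let c := cid (step n (projT1 t) (projT2 t)) in
  exist _ (projT1 c) (let: And5 g _ _ _ _ := projT2 c in g).
pose s := fix s n : T n := if n is m.+1 then nxt m (s m) else t0.
pose q n := projT1 (s n).
have qg n : good n (q n) by exact: (projT2 (s n)).
have qS n : [/\ (q n).1 <= (q n.+1).1, (q n.+1).1 + H / 2 ^+ n.+1 <= (q n).1 + H / 2 ^+ n,
    (q n).2 <= (q n.+1).2 & (q n.+1).2 + K / 2 ^+ n.+1 <= (q n).2 + K / 2 ^+ n].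
  rewrite /q /= /nxt /=; case: cid => r [] /=; by split.
(* The left endpoints increase and stay below every right endpoint, so their supremum lies in all
   the intervals. *)
have nest (u : nat -> R) (L : R) : 0 < L -> (forall n, u n <= u n.+1) ->
    (forall n, u n.+1 + L / 2 ^+ n.+1 <= u n + L / 2 ^+ n) ->
    exists l, forall n, u n <= l <= u n + L / 2 ^+ n.
  move=> L0 u1 u2.
  have m1 n m : u n <= u (n + m)%N.
    by elim: m => [|m IH]; rewrite ?addn0 // addnS (le_trans IH).
  have m2 n m : u (n + m)%N + L / 2 ^+ (n + m) <= u n + L / 2 ^+ n.
    by elim: m => [|m IH]; rewrite ?addn0 // addnS (le_trans _ IH).
  have ub n m : u m <= u n + L / 2 ^+ n.
    apply: le_trans (m1 m n) _; rewrite addnC; apply: le_trans (m2 n m).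
    by rewrite lerDl ltW // pos.
  exists (sup (range u)) => n; apply/andP; split.
    apply: ub_le_sup; last by exists n.
    by exists (u 0%N + L / 2 ^+ 0) => _ [m _ <-]; exact: ub.
  apply: ge_sup; first by exists (u 0%N); exists 0%N.
  by move=> _ [m _ <-]; exact: ub.
have [x0 hx0] : exists l, forall n, (q n).1 <= l <= (q n).1 + H / 2 ^+ n.
  by apply: nest => // n; have [] := qS n.
have [y0 hy0] : exists l, forall n, (q n).2 <= l <= (q n).2 + K / 2 ^+ n.
  by apply: nest => // n; have [] := qS n.
have q0 : q 0%N = (X, Y) by [].
have [||d d0 hd] := loc x0 y0.
- by have := hx0 0%N; rewrite q0 /= expr0 divr1.
- by have := hy0 0%N; rewrite q0 /= expr0 divr1.
have [n hn] : exists n, (H + K) / 2 ^+ n < d.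
  pose N := Num.bound ((H + K) / d); exists N.
  rewrite ltr_pdivrMr ?exprn_gt0 // mulrC -ltr_pdivrMr //.
  have hN : (H + K) / d < N%:R.
    by apply: archi_boundP; rewrite divr_ge0 ?addr_ge0 // ltW.
  apply: lt_trans hN _.
  by rewrite -natrX ltr_nat ltn_expl.
have [nPn a1 a2 a3 a4] := qg n.
have h1 := pos H n H0; have h2 := pos K n K0.
rewrite mulrDl in hn.
by apply: nPn; apply: hd => //; lra.
Qed.

(** This is the mean value theorem, with [F b - F a] in the role of the integral of [f]. The
    estimates of integrals below rest on it. *)
Lemma deriv_close (R : realType) (F f : R -> R) (a b c e : R) :
  a <= b -> (forall x, a <= x <= b -> is_derive x 1 F (f x)) ->
  (forall x, a <= x <= b -> `|f x - c| <= e) -> `|F b - F a - c * (b - a)| <= e * (b - a).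
Proof.
move=> ab dF bf; have [->|nab] := eqVneq a b; first by rewrite !subrr !mulr0 subrr normr0.
have ltab : a < b by rewrite lt_neqAle nab.
have [||z] := @MVT _ F f a b ltab.
- by move=> x; rewrite in_itv /= => /andP[h1 h2]; apply: dF; rewrite !ltW.
- apply: derivable_within_continuous => x; rewrite in_itv /= => xab.
  by have [] := dF _ xab.
rewrite in_itv /= => /andP[h1 h2] ->; rewrite -mulrBl normrM (ger0_norm (x := b - a)) ?subr_ge0 //.
by rewrite ler_wpM2r ?subr_ge0 // bf // !ltW.
Qed.

(** Lebesgue integration enters only here, through the fundamental theorem of calculus; afterwards
    an integral is a difference of two values of a primitive. *)
Lemma has_primitive (R : realType) (f : R -> R) (a b : R) :
  (forall x, a <= x <= b -> {for x, continuous f}) ->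
  exists F, forall x, a < x < b -> is_derive x 1 F (f x).
Proof.
move=> cf; pose F x := (\int[lebesgue_measure]_(t in `[a, x]) f t)%R.
exists F => x /andP[ax xb].
have [] := @continuous_FTC1_closed R f a x b xb _ ax _.
- apply: continuous_compact_integrable; first exact: segment_compact.
  by apply: continuous_in_subspaceT => y; rewrite inE /= in_itv /=; exact: cf.
- by apply: cf; rewrite !ltW.
by move=> d1 d2; split; [exact: d1 | rewrite -derive1E; exact: d2].
Qed.

(** * Goursat's lemma on rectangles *)

Section Goursat.
(** [U + iV] is the function to be integrated, with primitives [PU] of [U] along vertical lines and
    [PV] of [V] along horizontal ones. [UVdiff] is complex differentiability with derivative
    [al + i be], split into real and imaginary parts; on the vertical lines over [E] only continuity
    is assumed. *)
Variables (R : realType) (U V PU PV : R -> R -> R) (X Y H K : R) (E : seq R).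
Let inR x y := (X <= x <= X + H) && (Y <= y <= Y + K).
Hypotheses (H0 : 0 < H) (K0 : 0 < K).
Hypothesis dPU : forall x y, inR x y -> is_derive y 1 (PU x) (U x y).
Hypothesis dPV : forall x y, inR x y -> is_derive x 1 (PV ^~ y) (V x y).
Hypothesis UVcont : forall x0 y0 (e : R), inR x0 y0 -> 0 < e -> exists2 d : R, 0 < d &
  forall x y, inR x y -> `|x - x0| < d -> `|y - y0| < d ->
    `|U x y - U x0 y0| <= e /\ `|V x y - V x0 y0| <= e.
Hypothesis UVdiff : forall x0 y0, inR x0 y0 -> x0 \notin E -> exists al be : R,
  forall e : R, 0 < e -> exists2 d : R, 0 < d &
  forall x y, inR x y -> `|x - x0| < d -> `|y - y0| < d ->
    `|U x y - U x0 y0 - (al * (x - x0) - be * (y - y0))| <= e * (`|x - x0| + `|y - y0|) /\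
    `|V x y - V x0 y0 - (be * (x - x0) + al * (y - y0))| <= e * (`|x - x0| + `|y - y0|).

(* J is the integral of U dy + V dx, the imaginary part of (U + iV) dw, along the boundary. *)
Let W x y := PU x y - PV x y.
Let J x1 x2 y1 y2 := W x2 y2 - W x2 y1 - W x1 y2 + W x1 y1.

(** Each pair of opposite sides is estimated by [deriv_close]. Both pairs contribute the same term
    [c (x2 - x1) (y2 - y1)], which cancels in [J]. *)
Let J_le (x1 x2 y1 y2 c e : R) : X <= x1 -> x1 <= x2 -> x2 <= X + H ->
  Y <= y1 -> y1 <= y2 -> y2 <= Y + K ->
  (forall y, y1 <= y <= y2 -> `|U x2 y - U x1 y - c * (x2 - x1)| <= e) ->
  (forall x, x1 <= x <= x2 -> `|V x y2 - V x y1 - c * (y2 - y1)| <= e) ->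
  `|J x1 x2 y1 y2| <= e * ((x2 - x1) + (y2 - y1)).
Proof.
move=> hx1 hx hx2 hy1 hy hy2 hU hV.
have := @deriv_close R (PU x2 - PU x1) (fun y => U x2 y - U x1 y) y1 y2 (c * (x2 - x1)) e hy.
have h1 : forall y, y1 <= y <= y2 -> is_derive y 1 (PU x2 - PU x1) (U x2 y - U x1 y).
  move=> y /andP[ya yb]; apply: is_deriveB; apply: dPU; rewrite /inR; lra.
move=> /(_ h1 hU) {}h1.
have := @deriv_close R (PV^~ y2 - PV^~ y1) (fun x => V x y2 - V x y1) x1 x2 (c * (y2 - y1)) e hx.
have h2 : forall x, x1 <= x <= x2 -> is_derive x 1 (PV^~ y2 - PV^~ y1) (V x y2 - V x y1).
  move=> x /andP[ya yb]; apply: is_deriveB; apply: dPV; rewrite /inR; lra.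
move=> /(_ h2 hV) {}h2.
rewrite mulrDr [leRHS]addrC; apply: le_trans (lerD h1 h2).
rewrite (_ : J _ _ _ _ = ((PU x2 - PU x1) y2 - (PU x2 - PU x1) y1 - c * (x2 - x1) * (y2 - y1)) -
  ((PV^~ y2 - PV^~ y1) x2 - (PV^~ y2 - PV^~ y1) x1 - c * (y2 - y1) * (x2 - x1))) ?ler_normB //.
by rewrite /J /W !fctE; ring.
Qed.

(* On the exceptional lines x = s, s in E, the function J is only o(perimeter); the jumps of st make mu
   dominate the perimeter of the small rectangles meeting such a line. *)
Let st (x : R) : R := \sum_(s <- E) ((s < x)%R%:R + (s <= x)%R%:R).
Let mu x1 x2 y1 y2 := (x2 - x1) * (y2 - y1) + (st x2 - st x1) * (y2 - y1).

Let st_incr x1 x2 : x1 <= x2 -> 0 <= st x2 - st x1.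
Proof.
move=> x12; rewrite subr_ge0; apply: ler_sum => s _.
by apply: lerD; rewrite ler_nat; case: (ltP s x1) => h1; case: (ltP s x2) => h2 //;
 case: (leP s x1) => h3; case: (leP s x2) => h4 //; lra.
Qed.

(** Each [s] in [E] contributes 0, 1 or 2 to [st x], according as x < s, x = s or x > s. A jump of
    at least 1 is therefore seen even when [x0] is an endpoint of the interval. *)
Let st_jump x1 x0 x2 : x0 \in E -> x1 <= x0 <= x2 -> x1 < x2 -> 1 <= st x2 - st x1.
Proof.
move=> xE /andP[h1 h2] x12; rewrite /st -sumrB (big_rem x0) //= -[leLHS]addr0.
apply: lerD; first last.
  apply: sumr_ge0 => s _; case: (ltP s x1) => h3; case: (ltP s x2) => h4 //;
  case: (leP s x1) => h5; case: (leP s x2) => h6 //=; lra.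
rewrite (ltNge x0 x1) h1 h2 add0r.
by case: (ltP x0 x2) => h4; case: (leP x0 x1) => h5; rewrite /= ?mulr1n ?mulr0n; lra.
Qed.

Let dist_le (x h x0 x' : R) : x <= x0 <= x + h -> x <= x' <= x + h -> `|x' - x0| <= h.
Proof. by move=> /andP[? ?] /andP[? ?]; rewrite ler_norml; lra. Qed.

Let sub_inR (x h y k x' y' : R) : X <= x -> x + h <= X + H -> Y <= y -> y + k <= Y + K ->
  x <= x' <= x + h -> y <= y' <= y + k -> inR x' y'.
Proof. by move=> c1 c2 c3 c4 /andP[? ?] /andP[? ?]; rewrite /inR; apply/andP; split; lra. Qed.

Lemma goursat_rect : J X (X + H) Y (Y + K) = 0.
Proof.
(* All dyadic subrectangles have the same shape, so with sides h and k the ratios [C] = (h + k)^2 /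
   (h k) and [D] = (h + k) / k do not depend on the level. *)
pose C := (H + K) ^+ 2 / (H * K).
have C0 : 0 < C by rewrite divr_gt0 ?exprn_gt0 ?addr_gt0 ?mulr_gt0.
pose D := (H + K) / K.
have D0 : 0 < D by rewrite divr_gt0 ?addr_gt0.
(* Both [J] and [mu] are additive under subdivision, so a bound of [J] by [e * mu] passes from the
   quarters to the whole rectangle. *)
suff main e : 0 < e -> `|J X (X + H) Y (Y + K)| <= e * mu X (X + H) Y (Y + K).
  have mu0 : 0 < mu X (X + H) Y (Y + K).
    rewrite /mu ltr_pwDl //; first by rewrite mulr_gt0 // addrAC subrr add0r.
    by rewrite mulr_ge0 ?st_incr // ?lerDl ?ltW // addrAC subrr add0r.
  apply/eqP; rewrite -normr_eq0 eq_le normr_ge0 andbT leNgt; apply/negP => h.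
  have := main (`|J X (X + H) Y (Y + K)| / mu X (X + H) Y (Y + K) / 2).
  rewrite !divr_gt0 // => /(_ isT); rewrite mulrAC divfK ?gt_eqF //; lra.
move=> e0.
pose P n x y := `|J x (x + H / 2 ^+ n) y (y + K / 2 ^+ n)| <=
  e * mu x (x + H / 2 ^+ n) y (y + K / 2 ^+ n).
suff : P 0%N X Y by rewrite /P expr0 !divr1.
apply: (@bisection_rect R P X Y H K) => //.
  move=> n x y /=; rewrite /P.
  have -> : H / 2 ^+ n = H / 2 ^+ n.+1 + H / 2 ^+ n.+1 by rewrite exprS; field.
  have -> : K / 2 ^+ n = K / 2 ^+ n.+1 + K / 2 ^+ n.+1 by rewrite exprS; field.
  move: (H / _) (K / _) => h k; rewrite !addrA => h1 h2 h3 h4.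
  apply: le_trans (_ : _ <= `|J x (x + h) y (y + k)| + `|J (x + h) (x + h + h) y (y + k)|
     + `|J x (x + h) (y + k) (y + k + k)| + `|J (x + h) (x + h + h) (y + k) (y + k + k)|) _.
    rewrite (_ : J x (x + h + h) y _ = J x (x + h) y (y + k) + J (x + h) (x + h + h) y (y + k)
     + J x (x + h) (y + k) (y + k + k) + J (x + h) (x + h + h) (y + k) (y + k + k)); last first.
      by rewrite /J; ring.
    by rewrite !(le_trans (ler_normD _ _)) // lerD2r (le_trans (ler_normD _ _)) // lerD2r ler_normD.
  apply: le_trans (lerD (lerD (lerD h1 h2) h3) h4) _.
  by rewrite le_eqVlt; apply/orP; left; apply/eqP; rewrite /mu; ring.
have hk n : let h := H / 2 ^+ n in let k := K / 2 ^+ n in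
  [/\ 0 < h, 0 < k, (h + k) * (h + k) = C * (h * k) & h + k = D * k].
  have p2 : 0 < 2 ^+ n :> R by rewrite exprn_gt0.
  split; rewrite ?divr_gt0 //; rewrite /C /D; field; rewrite ?gt_eqF //.
move=> x0 y0 hx0 hy0.
have inR0 : inR x0 y0 by rewrite /inR; lra.
have [xE|xE] := boolP (x0 \in E).
(* On an exceptional line continuity bounds [J] by (e / D) (h + k) = e k, and the jump of [st] makes
   [mu] at least k. *)
- have [||d d0 hd] := @UVcont x0 y0 (e / (2 * D)); [by rewrite /inR hx0|by apply: divr_gt0; [exact: e0|apply: mulr_gt0; [exact: ltr0n|exact: D0]]|].
  exists d => // n x y /=; rewrite /P; have [] := hk n; move: (H / _) (K / _) => h k h0 k0 _ hD hd1 kd1 hx hy c1 c2 c3 c4.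
  have [xh yk] : x <= x + h /\ y <= y + k by rewrite !lerDl !ltW.
  have hd' x' y' : x <= x' <= x + h -> y <= y' <= y + k ->
    `|U x' y' - U x0 y0| <= e / (2 * D) /\ `|V x' y' - V x0 y0| <= e / (2 * D).
    move=> hx' hy'; apply: hd; first exact: sub_inR c1 c2 c3 c4 hx' hy'.
      exact: le_lt_trans (dist_le hx hx') hd1.
    exact: le_lt_trans (dist_le hy hy') kd1.
  apply: le_trans (_ : _ <= e / D * (h + k)) _; last first.
    rewrite hD mulrA divfK ?gt_eqF // ler_wpM2l ?(ltW e0) // /mu.
    rewrite -[leLHS]add0r lerD //; first by apply: mulr_ge0; rewrite subr_ge0.
    have j := @st_jump _ _ _ xE hx.
    by rewrite addrAC subrr add0r ler_peMl ?(ltW k0) // j // ltrDl.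
  have := @J_le x (x + h) y (y + k) 0 (e / D).
  rewrite (_ : x + h - x = h); last ring.
  rewrite (_ : y + k - y = k); last ring.
  have tri (A B c : R) : `|A - c| <= e / (2 * D) -> `|B - c| <= e / (2 * D) -> `|A - B - 0| <= e / D.
    move=> hA hB; rewrite subr0 (_ : A - B = (A - c) - (B - c)); last by ring.
    rewrite (_ : e / D = e / (2 * D) + e / (2 * D)); last by field; rewrite gt_eqF.
    by rewrite (le_trans (ler_normB _ _)) // lerD.
  apply => //; rewrite ?lerDl ?ltW //.
  + move=> z hz; rewrite mul0r.
    have [|//|u1 _] := hd' (x + h) z; first by rewrite xh lexx.
    have [|//|u2 _] := hd' x z; first by rewrite xh lexx.
    exact: tri u1 u2.
  + move=> z hz; rewrite mul0r.
    have [//||_ u1] := hd' z (y + k); first by rewrite yk lexx.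
    have [//||_ u2] := hd' z y; first by rewrite yk lexx.
    exact: tri u1 u2.
(* At a regular point the linear part gives the constant [al] for both pairs of sides; the remainder
   is at most (e / C) (h + k)^2 = e h k, that is, e times the area. *)
- have [al [be hab]] := @UVdiff x0 y0 inR0 xE.
  have [|d d0 hd] := hab (e / (2 * C)).
    by apply: divr_gt0; [exact: e0|apply: mulr_gt0; [exact: ltr0n|exact: C0]].
  exists d => // n x y /=; rewrite /P; have [] := hk n; move: (H / _) (K / _) => h k h0 k0 hC _ hd1 kd1 hx hy c1 c2 c3 c4.
  have [xh yk] : x <= x + h /\ y <= y + k by rewrite !lerDl !ltW.
  have hd' x' y' : x <= x' <= x + h -> y <= y' <= y + k ->
    `|U x' y' - U x0 y0 - (al * (x' - x0) - be * (y' - y0))| <= e / (2 * C) * (h + k) /\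
    `|V x' y' - V x0 y0 - (be * (x' - x0) + al * (y' - y0))| <= e / (2 * C) * (h + k).
    move=> hx' hy'; have dx := dist_le hx hx'; have dy := dist_le hy hy'.
    have le1 : e / (2 * C) * (`|x' - x0| + `|y' - y0|) <= e / (2 * C) * (h + k).
      apply: ler_wpM2l; first by apply: ltW; apply: divr_gt0; [exact: e0|apply: mulr_gt0; [exact: ltr0n|exact: C0]].
      exact: lerD.
    have [|||l1 l2] := hd x' y'; [exact: sub_inR c1 c2 c3 c4 hx' hy'|exact: le_lt_trans dx hd1|exact: le_lt_trans dy kd1|].
    by split; apply: (le_trans _ le1).
  apply: le_trans (_ : _ <= e / C * (h + k) * (h + k)) _; last first.
    rewrite (_ : e / C * (h + k) * (h + k) = e * (h * k)); last by rewrite -[LHS]mulrA hC; field; rewrite gt_eqF.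
    rewrite ler_wpM2l ?(ltW e0) // /mu.
    rewrite (_ : x + h - x = h); last ring.
    rewrite (_ : y + k - y = k); last ring.
    by rewrite lerDl mulr_ge0 ?(ltW k0) // st_incr // lerDl ltW.
  have := @J_le x (x + h) y (y + k) al (e / C * (h + k)).
  rewrite (_ : x + h - x = h); last ring.
  rewrite (_ : y + k - y = k); last ring.
  have tri (A B G : R) : `|A| <= e / (2 * C) * (h + k) -> `|B| <= e / (2 * C) * (h + k) -> 
     G = A - B -> `|G| <= e / C * (h + k).
    move=> hA hB ->.
    rewrite (_ : e / C * _ = e / (2 * C) * (h + k) + e / (2 * C) * (h + k)); last by field; rewrite gt_eqF.
    by rewrite (le_trans (ler_normB _ _)) // lerD.
  apply => //; rewrite ?lerDl ?ltW //.
  + move=> z hz.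
    have [|//|u1 _] := hd' (x + h) z; first by rewrite xh lexx.
    have [|//|u2 _] := hd' x z; first by rewrite xh lexx.
    by apply: tri u1 u2 _; ring.
  + move=> z hz.
    have [//||_ u1] := hd' z (y + k); first by rewrite yk lexx.
    have [//||_ u2] := hd' z y; first by rewrite yk lexx.
    by apply: tri u1 u2 _; ring.
Qed.
End Goursat.

Local Open Scope complex_scope.

(** * Complex differentiability *)

(** The field is arbitrary, so that one notion serves real and complex derivatives. *)
Definition has_deriv (K : numFieldType) (f : K -> K) (x L : K) : Prop :=
  (h^-1 *: ((f : K -> K^o) (h + x) - f x) : K^o) @[h --> (0 : K)^'] --> (L : K^o).

Lemma has_deriv_eps (K : numFieldType) (f : K -> K) (x L : K) : has_deriv f x L <->
  (forall e : K, 0 < e -> exists2 d : K, 0 < d & forall h, `|h| < d ->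
     `|f (x + h) - f x - L * h| <= e * `|h|).
Proof.
split=> [/cvgrPdist_le H e e0|H].
  have [d /= d0 hd] := H e e0; exists d => // h hh.
  have [->|h0] := eqVneq h 0; first by rewrite addr0 subrr mulr0 subrr !normr0 mulr0.
  have := hd h; rewrite /ball_ /= sub0r normrN => /(_ hh h0) h1.
  have -> : f (x + h) - f x - L * h = - ((L - h^-1 *: (f (h + x) - f x)) * h).
    rewrite mulrBl -[h^-1 *: _ * h]/(h^-1 * (f (h + x) - f x) * h) [h^-1 * _]mulrC.
    by rewrite mulfVK // [h + x]addrC opprB.
  by rewrite normrN normrM ler_wpM2r.
apply/cvgrPdist_le => e e0; have [d d0 hd] := H e e0.
exists d => //= h; rewrite /ball_ /= sub0r normrN => hh h0.
have := hd h hh; rewrite -ler_pdivrMr ?normr_gt0 // -normfV -normrM.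
rewrite mulrBl mulfK // [h^-1 *: _]mulrC distrC [h + x]addrC; exact.
Qed.

Lemma is_derive_has_deriv (K : numFieldType) (f : K -> K) (x L : K) :
  is_derive (x : K^o) 1 (f : K^o -> K^o) (L : K^o) <-> has_deriv f x L.
Proof.
have E : (fun h : K => h^-1 *: (((f : K^o -> K^o) \o shift (x : K^o)) (h *: (1 : K^o)) - f x) : K^o) =
         (fun h : K => h^-1 *: ((f : K -> K^o) (h + x) - f x) : K^o).
  by apply/funext => h /=; rewrite /shift /= [h *: 1]mulr1.
split=> [[H HL]|H].
  by rewrite /has_deriv -HL /derive -E.
split; first by apply/cvg_ex; exists L; rewrite E.
by rewrite /derive E; apply: (cvg_lim _ H); exact: norm_hausdorff.
Qed.

Lemma has_deriv_derive1 (K : numFieldType) (f : K -> K) (x L : K) :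
  has_deriv f x L -> derive1 (f : K -> K^o) x = L.
Proof. by move=> H; apply: (cvg_lim _ H); exact: norm_hausdorff. Qed.

Section CAbs.
Variable R : realType.
Local Notation C := (R[i])%C.
Implicit Types (z w : C).

Lemma cabsE (z : C) : `|z| = (cabs z)%:C. Proof. by []. Qed.

Lemma realCM (x y : R) : (x * y)%:C = x%:C * y%:C :> C. Proof. exact: rmorphM. Qed.

Lemma cabsM z w : cabs (z * w) = cabs z * cabs w.
Proof. exact: Normc.normcM. Qed.
Lemma cabs0 : cabs (0 : C) = 0. Proof. exact: Normc.normc0. Qed.
Lemma cabs1 : cabs (1 : C) = 1. Proof. exact: Normc.normc1. Qed.
Lemma cabsN z : cabs (- z) = cabs z.
Proof. by apply: (@complexI R); rewrite -!cabsE normrN. Qed.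
Lemma cabs_ge0 z : 0 <= cabs z.
Proof. by rewrite -lecR -cabsE normr_ge0. Qed.
Lemma cabs_eq0 z : (cabs z == 0) = (z == 0).
Proof. by rewrite -(inj_eq (@complexI R)) -cabsE normr_eq0. Qed.
Lemma cabs_gt0 z : (0 < cabs z) = (z != 0).
Proof. by rewrite lt_neqAle cabs_ge0 andbT eq_sym cabs_eq0. Qed.
Lemma cabsV z : cabs z^-1 = (cabs z)^-1.
Proof. exact: Normc.normcV. Qed.
Lemma cabsX z n : cabs (z ^+ n) = cabs z ^+ n.
Proof. by elim: n => [|n IH]; rewrite ?expr0 ?cabs1 // !exprS cabsM IH. Qed.
Lemma ler_cabsD z w : cabs (z + w) <= cabs z + cabs w.
Proof. by rewrite -lecR rmorphD /= -!cabsE ler_normD. Qed.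
Lemma ler_cabsB z w : cabs (z - w) <= cabs z + cabs w.
Proof. by rewrite (le_trans (ler_cabsD _ _)) // cabsN. Qed.
Lemma cabs_sub z w : cabs (z - w) = cabs (w - z).
Proof. by rewrite -cabsN opprB. Qed.
Lemma ler_cabs_sub z w : cabs z - cabs w <= cabs (z - w).
Proof. by rewrite lerBlDr -{1}(subrK w z) ler_cabsD. Qed.
Lemma cabs_real (x : R) : cabs x%:C = `|x|.
Proof. by rewrite /cabs /Normc.normc /= expr0n /= addr0 sqrtr_sqr. Qed.
Lemma sqr_cabs z : cabs z ^+ 2 = complex.Re z ^+ 2 + complex.Im z ^+ 2.
Proof. by case: z => a b; rewrite /cabs /Normc.normc sqr_sqrtr ?addr_ge0 ?sqr_ge0. Qed.
Lemma Re_le_cabs z : `|complex.Re z| <= cabs z.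
Proof.
rewrite -(@ler_pXn2r _ 2) ?nnegrE ?cabs_ge0 //.
by rewrite sqr_cabs real_normK ?num_real // lerDl sqr_ge0.
Qed.
Lemma Im_le_cabs z : `|complex.Im z| <= cabs z.
Proof.
rewrite -(@ler_pXn2r _ 2) ?nnegrE ?cabs_ge0 //.
by rewrite sqr_cabs real_normK ?num_real // lerDr sqr_ge0.
Qed.
Lemma cabs_le_ReIm z : cabs z <= `|complex.Re z| + `|complex.Im z|.
Proof.
rewrite -(@ler_pXn2r _ 2) ?nnegrE ?cabs_ge0 ?addr_ge0 //.
rewrite sqr_cabs sqrrD !real_normK ?num_real //.
by rewrite lerD2r lerDl mulrn_wge0 // mulr_ge0.
Qed.

(** Tolerances and moduli are taken in [R], so that estimates stay in the ordered field. *)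
Definition cderiv (f : C -> C) (z L : C) := forall e : R, 0 < e ->
  exists2 d : R, 0 < d & forall h, cabs h < d ->
  cabs (f (z + h) - f z - L * h) <= e * cabs h.

Definition ccont (f : C -> C) (z : C) := forall e : R, 0 < e ->
  exists2 d : R, 0 < d & forall h, cabs h < d -> cabs (f (z + h) - f z) <= e.

Lemma cderivE (f : C -> C) (z L : C) : cderiv f z L <-> has_deriv f z L.
Proof.
split=> [H|/has_deriv_eps H].
  apply/has_deriv_eps => e e0.
  have eR : e = (complex.Re e)%:C by rewrite RRe_real // gtr0_real.
  rewrite eR ltcR in e0; have [d d0 hd] := H _ e0.
  exists d%:C; rewrite ?ltcR // => h; rewrite cabsE ltcR => /hd hx.
  by rewrite {1}eR !cabsE; rewrite -lecR realCM in hx; exact: hx.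
move=> e e0; have [|d d0 hd] := H e%:C; first by rewrite ltcR.
have dR : d = (complex.Re d)%:C by rewrite RRe_real // gtr0_real.
rewrite dR ltcR in d0; exists (complex.Re d) => // h hh.
have hx := hd h; rewrite dR !cabsE ltcR in hx; have {}hx := hx hh.
by rewrite -lecR realCM; exact: hx.
Qed.

Lemma cderiv_is_derive (f : C -> C) (z L : C) :
  cderiv f z L <-> is_derive (z : C^o) 1 (f : C^o -> C^o) (L : C^o).
Proof. by rewrite cderivE is_derive_has_deriv. Qed.

Lemma derivableC (f : C -> C) (z : C) :
  derivable (f : C^o -> C^o) (z : C^o) 1 <-> exists L, cderiv f z L.
Proof.
split=> [H|[L /cderiv_is_derive []] //].
by exists ('D_1 (f : C^o -> C^o) (z : C^o)); apply/cderiv_is_derive; split.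
Qed.

Lemma cderiv_derive1 (f : C -> C) (z L : C) : cderiv f z L -> derive1 (f : C -> C^o) z = L.
Proof. by move=> /cderivE; exact: has_deriv_derive1. Qed.

Lemma cderiv_cont (f : C -> C) (z L : C) : cderiv f z L -> ccont f z.
Proof.
move=> H e e0; have [d d0 hd] := H 1 ltr01.
exists (Num.min d (e / (1 + cabs L))).
  by rewrite lt_min d0 divr_gt0 // ltr_pwDl // cabs_ge0.
move=> h; rewrite lt_min => /andP[/hd h1].
rewrite ltr_pdivlMr ?ltr_pwDl ?cabs_ge0 // => h2.
rewrite -(subrK (L * h) (_ - _)); apply: le_trans (ler_cabsD _ _) _.
rewrite cabsM; move: h1 h2; lra.
Qed.

Lemma cderiv_ext (f g : C -> C) (z L : C) (r : R) : 0 < r ->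
  (forall h, cabs h < r -> f (z + h) = g (z + h)) -> cderiv f z L -> cderiv g z L.
Proof.
move=> r0 fg H e e0; have [d d0 hd] := H e e0.
exists (Num.min d r); first by rewrite lt_min d0.
move=> h; rewrite lt_min => /andP[h1 h2]; rewrite -fg //.
by have := fg 0; rewrite addr0 cabs0 => <- //; exact: hd.
Qed.

Lemma ccont_ext (f g : C -> C) (z : C) (r : R) : 0 < r ->
  (forall h, cabs h < r -> f (z + h) = g (z + h)) -> ccont f z -> ccont g z.
Proof.
move=> r0 fg H e e0; have [d d0 hd] := H e e0.
exists (Num.min d r); first by rewrite lt_min d0.
move=> h; rewrite lt_min => /andP[h1 h2]; rewrite -fg //.
by have := fg 0; rewrite addr0 cabs0 => <- //; exact: hd.
Qed.

Lemma cderiv_cst (c z : C) : cderiv (fun=> c) z 0.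
Proof. by move=> e e0; exists 1 => // h _ /=; rewrite subrr mul0r subr0 cabs0 mulr_ge0 ?cabs_ge0 // ltW. Qed.

Lemma cderiv_id (z : C) : cderiv id z 1.
Proof.
move=> e e0; exists 1 => // h _ /=.
rewrite (_ : z + h - z - 1 * h = 0); last by ring.
by rewrite cabs0 mulr_ge0 ?cabs_ge0 // ltW.
Qed.

Lemma cderivD (f g : C -> C) (z L M : C) : cderiv f z L -> cderiv g z M ->
  cderiv (fun w => f w + g w) z (L + M).
Proof. by move=> /cderiv_is_derive H /cderiv_is_derive H'; apply/cderiv_is_derive; exact: is_deriveD. Qed.

Lemma cderivN (f : C -> C) (z L : C) : cderiv f z L -> cderiv (fun w => - f w) z (- L).
Proof. by move=> /cderiv_is_derive H; apply/cderiv_is_derive; exact: is_deriveN. Qed.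

Lemma cderivM (f g : C -> C) (z L M : C) : cderiv f z L -> cderiv g z M ->
  cderiv (fun w => f w * g w) z (f z * M + g z * L).
Proof. by move=> /cderiv_is_derive H /cderiv_is_derive H'; apply/cderiv_is_derive; exact: is_deriveM. Qed.

Lemma cderivV (f : C -> C) (z L : C) : f z != 0 -> cderiv f z L ->
  cderiv (fun w => (f w)^-1) z (- (f z) ^- 2 * L).
Proof.
move=> f0 /cderiv_is_derive [H HL]; apply/cderiv_is_derive; split; first exact: derivableV.
by rewrite deriveV // HL.
Qed.

Lemma cderiv_comp (f g : C -> C) (z L M : C) : cderiv f z L -> cderiv g (f z) M ->
  cderiv (fun w => g (f w)) z (M * L).
Proof.
move=> Hf Hg e e0.
pose B := 1 + cabs L.
have B0 : 0 < B by rewrite ltr_pwDl // cabs_ge0.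
have M0 : 0 < 2 * (1 + cabs M) by rewrite mulr_gt0 // ltr_pwDl // cabs_ge0.
have [|d2 d20 h2] := Hg (e / (2 * B)); first by rewrite divr_gt0 ?mulr_gt0.
have [|d1 d10 h1] := Hf (Num.min 1 (e / (2 * (1 + cabs M)))).
  by rewrite lt_min ltr01 divr_gt0.
exists (Num.min d1 (d2 / B)); first by rewrite lt_min d10 divr_gt0.
move=> h; rewrite lt_min ltr_pdivlMr // => /andP[/h1 hA hB].
pose k := f (z + h) - f z.
have hA1 : cabs (k - L * h) <= cabs h.
  by apply: le_trans hA _; rewrite ler_piMl ?cabs_ge0 // ge_min lexx.
have hA2 : cabs (k - L * h) <= e / (2 * (1 + cabs M)) * cabs h.
  by apply: le_trans hA _; rewrite ler_wpM2r ?cabs_ge0 // ge_min lexx orbT.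
have kB : cabs k <= B * cabs h.
  rewrite -(subrK (L * h) k); apply: le_trans (ler_cabsD _ _) _.
  by rewrite /B mulrDl mul1r cabsM lerD2r.
have := h2 k; rewrite [f z + k]addrC subrK => /(_ (le_lt_trans kB _)).
rewrite mulrC => /(_ hB) hC.
have -> : g (f (z + h)) - g (f z) - M * L * h = (g (f (z + h)) - g (f z) - M * k) + M * (k - L * h) by ring.
apply: le_trans (ler_cabsD _ _) _; rewrite cabsM.
have -> : e * cabs h = e / (2 * B) * (B * cabs h) + (1 + cabs M) * (e / (2 * (1 + cabs M)) * cabs h).
  by field; rewrite !gt_eqF //; move: M0; lra.
apply: lerD.
  by apply: le_trans hC _; rewrite ler_wpM2l // ltW // divr_gt0 ?mulr_gt0.
by apply: ler_pM; rewrite ?cabs_ge0 // lerDr.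
Qed.

Lemma ccontD (f g : C -> C) (z : C) : ccont f z -> ccont g z -> ccont (fun w => f w + g w) z.
Proof.
move=> Hf Hg e e0.
have e2 : 0 < e / 2 by rewrite divr_gt0.
have [d1 d10 h1] := Hf _ e2; have [d2 d20 h2] := Hg _ e2.
exists (Num.min d1 d2); first by rewrite lt_min d10.
move=> h; rewrite lt_min => /andP[/h1 hA /h2 hB].
have -> : f (z + h) + g (z + h) - (f z + g z) = (f (z + h) - f z) + (g (z + h) - g z) by ring.
by apply: le_trans (ler_cabsD _ _) _; rewrite [leRHS]splitr lerD.
Qed.

Lemma ccontM (f g : C -> C) (z : C) : ccont f z -> ccont g z -> ccont (fun w => f w * g w) z.
Proof.
move=> Hf Hg e e0.
pose B := 1 + cabs (f z) + cabs (g z).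
have B1 : 1 <= B by rewrite /B; have := cabs_ge0 (f z); have := cabs_ge0 (g z); lra.
have B0 : 0 < B by lra.
have e2 : 0 < Num.min 1 (e / (2 * B)) by rewrite lt_min ltr01 divr_gt0 // mulr_gt0.
have [d1 d10 h1] := Hf _ e2; have [d2 d20 h2] := Hg _ e2.
exists (Num.min d1 d2); first by rewrite lt_min d10.
move=> h; rewrite lt_min => /andP[/h1 + /h2].
rewrite !le_min => /andP[hA1 hA] /andP[hB1 hB].
have -> : f (z + h) * g (z + h) - f z * g z = (f (z + h) - f z) * ((g (z + h) - g z) + g z) + f z * (g (z + h) - g z) by ring.
apply: le_trans (ler_cabsD _ _) _; rewrite !cabsM.
have -> : e = e / (2 * B) * B + B * (e / (2 * B)) by field; rewrite gt_eqF.
have b1 : cabs (g (z + h) - g z + g z) <= B.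
  by apply: le_trans (ler_cabsD _ _) _; rewrite /B; have := cabs_ge0 (f z); lra.
have b2 : cabs (f z) <= B by rewrite /B; have := cabs_ge0 (g z); lra.
by apply: lerD; apply: ler_pM; rewrite ?cabs_ge0.
Qed.

Lemma ccont_cst c z : ccont (fun=> c) z.
Proof. exact: cderiv_cont (cderiv_cst c z). Qed.

End CAbs.

(** * Integration along circles *)

Section Polar.
Variable R : realType.
Local Notation C := (R[i])%C.

Lemma is_derive_eps (f : R -> R) (x l : R) : is_derive x 1 f l ->
  forall e, 0 < e -> exists2 d : R, 0 < d & forall h, `|h| < d ->
     `|f (x + h) - f x - l * h| <= e * `|h|.
Proof. by move=> /is_derive_has_deriv /has_deriv_eps. Qed.

Definition cexp (z : C) : C :=
  (expR (complex.Re z) * cos (complex.Im z)) +i* (expR (complex.Re z) * sin (complex.Im z)).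

Lemma cexpD z w : cexp (z + w) = cexp z * cexp w.
Proof.
case: z w => [a b] [c d]; rewrite /cexp /= expRD cosD sinD.
by apply/eqP; rewrite eq_complex /=; apply/andP; split; apply/eqP; ring.
Qed.

Lemma cabs_cexp z : cabs (cexp z) = expR (complex.Re z).
Proof.
apply/eqP; rewrite -(@eqrXn2 _ 2) ?cabs_ge0 ?expR_ge0 //; apply/eqP.
by rewrite sqr_cabs /= !exprMn -mulrDr cos2Dsin2 mulr1.
Qed.

(** At 0 the estimate follows from the derivatives of [expR], [cos] and [sin]; the functional
    equation [cexpD] carries it to [z]. *)
Lemma cderiv_cexp z : cderiv cexp z (cexp z).
Proof.
have h0 : cderiv cexp 0 1.
  move=> e e0.
  have e4 : 0 < Num.min 1 (e / 12) by rewrite lt_min ltr01 divr_gt0.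
  have [d1 d10 h1] := is_derive_eps (is_derive_expR (0:R)) e4.
  have [d2 d20 h2] := is_derive_eps (is_derive_sin (0:R)) e4.
  have [d3 d30 h3] := is_derive_eps (is_derive_cos (0:R)) e4.
  exists (Num.min (Num.min d1 (Num.min d2 d3)) (Num.min (1/2) (e / 12))).
    by rewrite !lt_min d10 d20 d30 !divr_gt0.
  move=> h; rewrite !lt_min => /andP[/and3P[hd1 hd2 hd3] /andP[hd4 hd5]].
  have := Re_le_cabs h; have := Im_le_cabs h.
  have cabsh := cabs_ge0 h.
  set u := complex.Re h; set v := complex.Im h => hv hu.
  have := h1 u (le_lt_trans hu hd1); have := h2 v (le_lt_trans hv hd2); have := h3 v (le_lt_trans hv hd3).
  rewrite !add0r expR0 sin0 cos0 oppr0 !mul0r ?subr0 ?addr0 !mul1r.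
  have m2 : Num.min 1 (e/12) <= e / 12 by rewrite ge_min lexx orbT.
  move=> hcos hsin hexp.
  have bnd (A B : R) : `|A| <= Num.min 1 (e/12) * `|B| -> `|B| <= cabs h -> `|A| <= e / 12 * cabs h.
    by move=> l1 l2; apply: le_trans l1 _; apply: ler_pM => //; rewrite le_min ler01 divr_ge0 // ltW.
  have bnd1 (A B : R) : `|A| <= Num.min 1 (e/12) * `|B| -> `|A| <= `|B|.
    by move=> l1; apply: le_trans l1 _; rewrite ler_piMl // ge_min lexx.
  have ex2 : `|expR u - 1| <= 2 * `|u|.
    have := bnd1 _ _ hexp => l1.
    rewrite -(subrK u (expR u - 1)); apply: le_trans (ler_normD _ _) _; lra.
  have ex1 : `|expR u| <= 2.
    rewrite -(subrK 1 (expR u)); apply: le_trans (ler_normD _ _) _; rewrite normr1; lra.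
  have c0 := bnd _ _ hcos hv; have s0 := bnd _ _ hsin hv; have x0 := bnd _ _ hexp hu.
  have E0 : cexp 0 = 1 by rewrite /cexp /= expR0 cos0 sin0 mulr1 mulr0.
  rewrite E0; apply: le_trans (cabs_le_ReIm _) _.
  have -> : complex.Re (cexp h - 1 - h) = (expR u - 1 - u) + expR u * (cos v - 1).
    by rewrite /cexp /u /v; case: (h) => a b /=; ring.
  have -> : complex.Im (cexp h - 1 - h) = expR u * (sin v - v) + (expR u - 1) * v.
    by rewrite /cexp /u /v; case: (h) => a b /=; ring.
  have l1 := ler_normD (expR u - 1 - u) (expR u * (cos v - 1)).
  have l2 := ler_normD (expR u * (sin v - v)) ((expR u - 1) * v).
  rewrite normrM in l1; rewrite !normrM in l2.
  have p1 : `|expR u| * `|cos v - 1| <= 2 * (e / 12 * cabs h) by apply: ler_pM.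
  have p2 : `|expR u| * `|sin v - v| <= 2 * (e / 12 * cabs h) by apply: ler_pM.
  have p3 : `|expR u - 1| * `|v| <= (2 * (e / 12)) * cabs h.
    by apply: ler_pM => //; apply: le_trans ex2 _; rewrite ler_wpM2l // (le_trans hu) // ltW.
  have eh := mulr_ge0 (ltW e0) cabsh; lra.
move=> e e0; have [d d0 hd] := h0 (e / expR (complex.Re z)) (divr_gt0 e0 (expR_gt0 _)).
exists d => // h /hd; rewrite add0r.
have E0 : cexp 0 = 1 by rewrite /cexp /= expR0 cos0 sin0 mulr1 mulr0.
rewrite E0 mul1r cexpD => H.
rewrite (_ : _ - _ - _ = cexp z * (cexp h - 1 - h)); last by ring.
rewrite cabsM cabs_cexp mulrC -ler_pdivlMr ?expR_gt0 //.
by apply: le_trans H _; rewrite mulrAC.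
Qed.

Lemma ccont_comp (f g : C -> C) (z : C) : ccont f z -> ccont g (f z) -> ccont (fun w => g (f w)) z.
Proof.
move=> Hf Hg e e0; have [d d0 hd] := Hg e e0.
have d2 : 0 < d / 2 by rewrite divr_gt0.
have [d' d'0 hd'] := Hf _ d2; exists d' => // h /hd' l.
have := hd (f (z + h) - f z); rewrite [f z + _]addrC subrK; apply.
by apply: le_lt_trans l _; lra.
Qed.

Lemma ReB z w : complex.Re (z - w : C) = complex.Re z - complex.Re w.
Proof. by case: z w => ? ? []. Qed.
Lemma ImB z w : complex.Im (z - w : C) = complex.Im z - complex.Im w.
Proof. by case: z w => ? ? []. Qed.

Lemma continuous_Re_line (g : R -> C) (t : R) :
  (forall e : R, 0 < e -> exists2 d : R, 0 < d & forall s, `|s - t| < d -> cabs (g s - g t) <= e) ->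
  {for t, continuous (fun s => complex.Re (g s))} /\ {for t, continuous (fun s => complex.Im (g s))}.
Proof.
move=> H; split; apply/cvgrPdist_le => e e0; have [d d0 hd] := H e e0.
  exists d => //= s; rewrite /ball_ /= distrC => /hd l.
  by rewrite distrC -ReB; apply: le_trans (Re_le_cabs _) l.
exists d => //= s; rewrite /ball_ /= distrC => /hd l.
by rewrite distrC -ImB; apply: le_trans (Im_le_cabs _) l.
Qed.

Lemma ccont_vert (g : C -> C) (x y : R) : ccont g (x +i* y) ->
  {for y, continuous (fun t => complex.Re (g (x +i* t)))} /\
  {for y, continuous (fun t => complex.Im (g (x +i* t)))}.
Proof.
move=> H; apply: (@continuous_Re_line (fun t => g (x +i* t))) => e e0.
have [d d0 hd] := H e e0; exists d => // s hs.
have := hd (0 +i* (s - y)); rewrite (_ : x +i* y + _ = x +i* s).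
  apply; apply: le_lt_trans (cabs_le_ReIm _) _; by rewrite normr0 add0r.
by apply/eqP; rewrite eq_complex /=; apply/andP; split; apply/eqP; ring.
Qed.

Lemma ccont_horiz (g : C -> C) (x y : R) : ccont g (x +i* y) ->
  {for x, continuous (fun t => complex.Re (g (t +i* y)))} /\
  {for x, continuous (fun t => complex.Im (g (t +i* y)))}.
Proof.
move=> H; apply: (@continuous_Re_line (fun t => g (t +i* y))) => e e0.
have [d d0 hd] := H e e0; exists d => // s hs.
have := hd ((s - x) +i* 0); rewrite (_ : x +i* y + _ = s +i* y).
  apply; apply: le_lt_trans (cabs_le_ReIm _) _; by rewrite normr0 addr0.
by apply/eqP; rewrite eq_complex /=; apply/andP; split; apply/eqP; ring.
Qed.

Local Notation T := (pi *+ 2 : R).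

(** [xget] picks some primitive on the open interval, and the zero function if there is none. *)
Definition prim (a b : R) (f : R -> R) : R -> R :=
  xget (fun=> 0) [set P | forall x, a < x < b -> is_derive x 1 P (f x)].

Lemma primP (a b : R) (f : R -> R) : (forall x, a <= x <= b -> {for x, continuous f}) ->
  forall x, a < x < b -> is_derive x 1 (prim a b f) (f x).
Proof.
move=> cf; have [P HP] := has_primitive cf.
exact: (@xgetPex _ (fun=> 0) [set P | forall x, a < x < b -> is_derive x 1 P (f x)] (ex_intro _ P HP)).
Qed.

(* The margin of 1 makes the primitive differentiable at both endpoints of [0, T]. *)
Definition rint (f : R -> R) : R := prim (-1) (T + 1) f T - prim (-1) (T + 1) f 0.
Definition cint (F : R -> C) : C :=
  rint (fun y => complex.Re (F y)) +i* rint (fun y => complex.Im (F y)).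

Lemma T_gt0 : 0 < T. Proof. by rewrite pmulrn_lgt0 // pi_gt0. Qed.

Lemma rint_prim (f : R -> R) : (forall x, {for x, continuous f}) ->
  forall x, 0 <= x <= T -> is_derive x 1 (prim (-1) (T + 1) f) (f x).
Proof. by move=> cf x hx; apply: primP => //; lra. Qed.

Lemma rint_close (f : R -> R) (c e : R) : (forall x, {for x, continuous f}) ->
  (forall x, 0 <= x <= T -> `|f x - c| <= e) -> `|rint f - c * T| <= e * T.
Proof.
move=> cf cl; have T0 := T_gt0.
have := @deriv_close R (prim (-1) (T + 1) f) f 0 T c e (ltW T0).
by rewrite subr0; apply => // x hx; apply: rint_prim.
Qed.

Lemma rint_unique (f P : R -> R) : (forall x, {for x, continuous f}) ->
  (forall x, 0 <= x <= T -> is_derive x 1 P (f x)) -> rint f = P T - P 0.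
Proof.
move=> cf dP; have T0 := T_gt0.
have := @deriv_close R (prim (-1) (T + 1) f - P) (fun x => f x - f x) 0 T 0 0 (ltW T0).
rewrite !mul0r subr0 normr_le0 => H; apply/eqP; rewrite -subr_eq0.
rewrite (_ : _ - _ = (prim (-1) (T + 1) f - P) T - (prim (-1) (T + 1) f - P) 0).
  apply: H => x hx; last by rewrite subrr subr0 normr0.
  by apply: is_deriveB; [exact: rint_prim|exact: dP].
by rewrite /rint !fctE; ring.
Qed.

Lemma rintD (f g : R -> R) (a b : R) : (forall x, {for x, continuous f}) -> (forall x, {for x, continuous g}) ->
  rint (fun x => a * f x + b * g x) = a * rint f + b * rint g.
Proof.
move=> cf cg; pose P x := a * prim (-1) (T + 1) f x + b * prim (-1) (T + 1) g x.
transitivity (P T - P 0); last by rewrite /rint /P; ring.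
apply: rint_unique.
- by move=> x; apply: cvgD; apply: cvgM; [exact: cvg_cst|exact: cf|exact: cvg_cst|exact: cg].
- move=> x hx; have d1 := rint_prim cf hx; have d2 := rint_prim cg hx.
  by apply: is_deriveD; apply: is_deriveZ.
Qed.

Definition rcont (F : R -> C) := forall t (e : R), 0 < e -> exists2 d : R, 0 < d &
  forall s, `|s - t| < d -> cabs (F s - F t) <= e.

Lemma rcontP F : rcont F -> (forall x, {for x, continuous (fun y => complex.Re (F y))}) /\
   (forall x, {for x, continuous (fun y => complex.Im (F y))}).
Proof. by move=> H; split=> x; have [] := continuous_Re_line (H x). Qed.

(** The factor 2 comes from treating real and imaginary parts separately. Crude constants suffice,
    since [maximum_principle] removes them by taking powers. *)
Lemma cint_le (F : R -> C) (M : R) : rcont F -> (forall y, 0 <= y <= T -> cabs (F y) <= M) ->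
  cabs (cint F) <= 2 * T * M.
Proof.
move=> /rcontP[c1 c2] bF; apply: le_trans (cabs_le_ReIm _) _ => /=.
have := rint_close (c := 0) (e := M) c1; rewrite mul0r subr0 => l1.
have := rint_close (c := 0) (e := M) c2; rewrite mul0r subr0 => l2.
rewrite (_ : 2 * T * M = M * T + M * T); last by ring.
apply: lerD; [apply: l1|apply: l2] => x hx; rewrite subr0.
  exact: le_trans (Re_le_cabs _) (bF x hx).
exact: le_trans (Im_le_cabs _) (bF x hx).
Qed.

Lemma cintD (F G : R -> C) : rcont F -> rcont G -> cint (fun y => F y + G y) = cint F + cint G.
Proof.
move=> /rcontP[f1 f2] /rcontP[g1 g2]; apply/eqP; rewrite eq_complex /=; apply/andP; split; apply/eqP.
  rewrite -[rint (fun y => complex.Re (F y))]mul1r -[rint (fun y => complex.Re (G y))]mul1r -rintD //.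
  by congr rint; apply/funext => y; rewrite !mul1r; case: (F y) (G y) => ? ? [].
rewrite -[rint (fun y => complex.Im (F y))]mul1r -[rint (fun y => complex.Im (G y))]mul1r -rintD //.
by congr rint; apply/funext => y; rewrite !mul1r; case: (F y) (G y) => ? ? [].
Qed.

Lemma cintZ (F : R -> C) (c : C) : rcont F -> cint (fun y => c * F y) = c * cint F.
Proof.
move=> /rcontP[f1 f2]; case: c => a b; apply/eqP; rewrite eq_complex /=; apply/andP; split; apply/eqP.
  rewrite -mulNr -rintD //.
  by congr rint; apply/funext => y; case: (F y) => ? ? /=; ring.
rewrite -rintD //.
by congr rint; apply/funext => y; case: (F y) => ? ? /=; ring.
Qed.

Lemma rcont_bounded (F : R -> C) : rcont F ->
  exists2 M : R, 0 < M & forall y, 0 <= y <= T -> cabs (F y) <= M.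
Proof.
move=> /rcontP[c1 c2]; have T0 := T_gt0.
have cn (f : R -> R) : (forall x, {for x, continuous f}) -> {within `[0, T], continuous (fun x => `|f x|)}.
  move=> cf; apply: continuous_subspaceT => x.
  by apply: continuous_comp; [exact: cf|exact: norm_continuous].
have [y1 _ h1] := EVT_max (ltW T0) (cn _ c1).
have [y2 _ h2] := EVT_max (ltW T0) (cn _ c2).
exists (`|complex.Re (F y1)| + `|complex.Im (F y2)| + 1); first by rewrite ltr_wpDl ?addr_ge0.
move=> y hy; apply: le_trans (cabs_le_ReIm _) _.
have := h1 y; have := h2 y; rewrite in_itv /= hy => /(_ isT) a /(_ isT) b; lra.
Qed.

End Polar.

(** * Cauchy's theorem for circles *)

Section Circle.
Variable R : realType.
Local Notation C := (R[i])%C.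
Local Notation T := (pi *+ 2 : R).

Lemma complex_addE (a b c d : R) : (a +i* b : C) + (c +i* d) = (a + c) +i* (b + d).
Proof. by []. Qed.

(** Goursat's lemma is applied to the rectangle between the abscissas [x1] and [x2] over one period;
    its horizontal sides cancel by periodicity, which leaves the two vertical ones. *)
Lemma rint_invariant (g : C -> C) (a b x1 x2 : R) (E : seq R) : a < x1 -> x1 < x2 -> x2 < b ->
  (forall x y, a <= x <= b -> ccont g (x +i* y)) ->
  (forall x y, a <= x <= b -> x \notin E -> exists L, cderiv g (x +i* y) L) ->
  (forall x, g (x +i* T) = g (x +i* 0)) ->
  rint (fun y => complex.Re (g (x2 +i* y))) = rint (fun y => complex.Re (g (x1 +i* y))).
Proof.
move=> ax xx xb cg dg pg; have T0 := @T_gt0 R.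
pose U x y := complex.Re (g (x +i* y)); pose V x y := complex.Im (g (x +i* y)).
pose PU x := prim (-1) (T + 1) (U x); pose PV x y := prim a b (V^~ y) x.
have near (x0 y0 x y d : R) : 0 < d -> `|x - x0| < d / 2 -> `|y - y0| < d / 2 ->
    cabs ((x - x0) +i* (y - y0)) < d /\ (x0 +i* y0) + ((x - x0) +i* (y - y0)) = x +i* y.
  move=> d0 h1 h2; split; first by apply: le_lt_trans (cabs_le_ReIm _) _ => /=; lra.
  by rewrite complex_addE ![_ + (_ - _)]addrC !subrK.
have := @goursat_rect R U V PU PV x1 0 (x2 - x1) T E; rewrite /= subr_gt0 add0r [x1 + _]addrC subrK.
have PVT x : PV x T = PV x 0.
  by rewrite /PV; congr (prim a b _ x); apply/funext => x'; rewrite /V pg.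
have -> : rint (fun y => complex.Re (g (x2 +i* y))) = PU x2 T - PU x2 0 by [].
have -> : rint (fun y => complex.Re (g (x1 +i* y))) = PU x1 T - PU x1 0 by [].
rewrite !PVT => H; suff : PU x2 T - PV x2 0 - (PU x2 0 - PV x2 0) - (PU x1 T - PV x1 0) + (PU x1 0 - PV x1 0) = 0.
  by move=> h; apply/eqP; rewrite -subr_eq0; apply/eqP; rewrite -[RHS]h; ring.
apply: H => //.
- move=> x y /andP[/andP[h1 h2] hy]; apply: rint_prim => // y'.
  have hx : a <= x <= b by lra.
  by have [] := ccont_vert (cg x y' hx).
- move=> x y /andP[/andP[h1 h2] hy]; apply: primP; last lra.
  by move=> x' hx'; have [] := ccont_horiz (cg x' y hx').
- move=> x0 y0 e /andP[/andP[h1 h2] hy] e0.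
  have hx : a <= x0 <= b by lra.
  have [d d0 hd] := cg x0 y0 hx e e0.
  exists (d / 2); first by rewrite divr_gt0.
  move=> x y _ hx' hy'; have [n1 n2] := near x0 y0 x y d d0 hx' hy'.
  have := hd _ n1; rewrite n2 => l; rewrite /U /V -ReB -ImB.
  by split; apply: le_trans l; [exact: Re_le_cabs|exact: Im_le_cabs].
- move=> x0 y0 /andP[/andP[h1 h2] hy] xE.
  have hx : a <= x0 <= b by lra.
  have [[al be] HL] := dg x0 y0 hx xE.
  exists al, be => e e0; have [d d0 hd] := HL e e0.
  exists (d / 2); first by rewrite divr_gt0.
  move=> x y _ hx' hy'; have [n1 n2] := near x0 y0 x y d d0 hx' hy'.
  have := hd _ n1; rewrite n2 => l.
  have {}l : cabs (g (x +i* y) - g (x0 +i* y0) - (al +i* be) * ((x - x0) +i* (y - y0))) <=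
    e * (`|x - x0| + `|y - y0|).
    by apply: le_trans l _; rewrite ler_wpM2l ?(ltW e0) //; exact: cabs_le_ReIm.
  split; apply: le_trans l.
    by apply: le_trans (Re_le_cabs _); rewrite !ReB.
  have e1 : complex.Im (((al +i* be) : C) * ((x - x0) +i* (y - y0))) = be * (x - x0) + al * (y - y0).
    by rewrite /= addrC.
  by apply: le_trans (Im_le_cabs _); rewrite !ImB e1.
Qed.

Definition circ (r y : R) : C := cexp (ln r +i* y).

Lemma cabs_circ r y : 0 < r -> cabs (circ r y) = r.
Proof. by move=> r0; rewrite cabs_cexp /= lnK. Qed.

Lemma rcont_circ r (q : C -> C) : (forall y, ccont q (circ r y)) -> rcont (fun y => q (circ r y)).
Proof.
move=> cq y e e0.
have [d d0 hd] := ccont_comp (cderiv_cont (cderiv_cexp (ln r +i* y))) (cq y) e0.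
exists d => // s hs; have := hd (0 +i* (s - y)).
rewrite complex_addE addr0 [y + _]addrC subrK; apply.
by apply: le_lt_trans (cabs_le_ReIm _) _ => /=; rewrite normr0 add0r.
Qed.

(** In the coordinate w = log zeta, circles about 0 become vertical segments over one period. By
    [rint_invariant] the integral does not change when the radius shrinks, and it tends to 0 because
    the integrand carries the factor zeta while [Phi] is bounded near 0. *)
Let Re_part (Phi : C -> C) (r r' : R) (S : seq C) : 0 < r -> r < r' ->
  (forall z, cabs z < r' -> ccont Phi z) ->
  (forall z, cabs z < r' -> z \notin S -> exists L, cderiv Phi z L) ->
  rint (fun y => complex.Re (circ r y * Phi (circ r y))) = 0.
Proof.
move=> r0 rr' cP dP; pose g w := cexp w * Phi (cexp w).
have T0 := @T_gt0 R.
have r'0 : 0 < r' by apply: lt_trans rr'.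
have lnrr : ln r < ln r' by rewrite ltr_ln // posrE.
pose b := (ln r + ln r') / 2.
have inr' x y : x <= b -> cabs (cexp (x +i* y)) < r'.
  move=> xb; rewrite cabs_cexp /= -[ltRHS](lnK r'0) ltr_expR; move: xb; rewrite /b; lra.
have cg x y : x <= b -> ccont g (x +i* y).
  move=> xb; apply: ccontM; first exact: cderiv_cont (cderiv_cexp _).
  by apply: (ccont_comp (cderiv_cont (cderiv_cexp _))); apply: cP; exact: inr'.
have inv x1 : x1 < ln r -> rint (fun y => complex.Re (g (ln r +i* y))) = rint (fun y => complex.Re (g (x1 +i* y))).
  (* A point s of [S] excludes the whole line Re w = ln |s|; if s = 0, the default value of [ln]
     only excludes one more line. *)
  move=> x1r; apply: (@rint_invariant g (x1 - 1) b x1 (ln r) [seq ln (cabs s) | s <- S]).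
  - lra.
  - exact: x1r.
  - rewrite /b; lra.
  - by move=> x y /andP[_]; exact: cg.
  - move=> x y /andP[_ xb] xE.
    have [||L HL] := dP (cexp (x +i* y)); first exact: inr'.
      apply/negP => inS; move/negP: xE; apply; apply/mapP; exists (cexp (x +i* y)) => //.
      by rewrite cabs_cexp /= expRK.
    eexists; apply: cderivM; first exact: cderiv_cexp.
    exact: cderiv_comp (cderiv_cexp _) HL.
  - move=> x; rewrite /g; suff -> : cexp (x +i* T) = cexp (x +i* 0) by [].
    by rewrite /cexp /= cos2pi sin2pi cos0 sin0.
apply/eqP; rewrite -normr_le0; apply/ler_addgt0Pl => e e0; rewrite addr0.
have [|d d0 hd] := cP 0 _ 1 ltr01; first by rewrite cabs0.
pose M := cabs (Phi 0) + 1.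
have M0 : 0 < M by rewrite ltr_wpDl ?cabs_ge0.
pose m := Num.min (Num.min d r) (e / (M * T)).
have m0 : 0 < m by rewrite !lt_min d0 r0 divr_gt0 ?mulr_gt0.
pose x1 := ln (m / 2).
have m2 : 0 < m / 2 by rewrite divr_gt0.
have mm : m / 2 < m by lra.
have mr : m <= r by rewrite !ge_min lexx orbT.
have md : m <= d by rewrite !ge_min lexx.
have me : m <= e / (M * T) by rewrite !ge_min lexx orbT.
have x1r : x1 < ln r by rewrite ltr_ln ?posrE //; lra.
rewrite (inv x1 x1r).
have := @rint_close R (fun y => complex.Re (g (x1 +i* y))) 0 (m / 2 * M).
rewrite mul0r subr0 => H; apply: le_trans (H _ _) _.
- have x1b : x1 <= b by rewrite /b; lra.
  by move=> y; have [] := ccont_vert (cg x1 y x1b).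
- move=> y _; rewrite subr0; apply: le_trans (Re_le_cabs _) _; rewrite cabsM.
  have cE : cabs (cexp (x1 +i* y)) = m / 2 by rewrite cabs_cexp /= lnK.
  rewrite cE ler_wpM2l ?(ltW m2) //.
  have := hd (cexp (x1 +i* y)); rewrite cE add0r => /(_ (lt_le_trans mm md)) l.
  rewrite -(subrK (Phi 0) (Phi _)); apply: le_trans (ler_cabsD _ _) _; rewrite /M; lra.
rewrite -[leLHS]mulrA -ler_pdivlMr ?mulr_gt0 //; lra.
Qed.

(* On the circle, d zeta = i zeta dy. *)
Lemma cauchy_circle (Phi : C -> C) (r r' : R) (S : seq C) : 0 < r -> r < r' ->
  (forall z, cabs z < r' -> ccont Phi z) ->
  (forall z, cabs z < r' -> z \notin S -> exists L, cderiv Phi z L) ->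
  cint (fun y => circ r y * Phi (circ r y)) = 0.
Proof.
move=> r0 rr' cP dP; apply/eqP; rewrite eq_complex /=; apply/andP; split; apply/eqP.
  exact: Re_part r0 rr' cP dP.
(* The imaginary part of a number is the real part of its product with -i. *)
rewrite -(@Re_part (fun w => (- 'i) * Phi w) r r' S r0 rr').
- congr rint; apply/funext => y; case: (circ r y) (Phi _) => ? ? [? ?] /=; ring.
- by move=> z hz; apply: ccontM; [exact: ccont_cst|exact: cP].
- move=> z hz zS; have [L HL] := dP z hz zS; eexists.
  by apply: cderivM; [exact: cderiv_cst|exact: HL].
Qed.

End Circle.

(** * Cauchy's formula and its consequences *)

Section CauchyFormula.
Variable R : realType.
Local Notation C := (R[i])%C.
Local Notation T := (pi *+ 2 : R).

(** When [L] is the derivative of [g] at [z], the prescribed value makes the difference quotient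
    continuous there. *)
Definition divdiff (g : C -> C) (z L w : C) : C :=
  if w == z then L else (g w - g z) / (w - z).

Lemma divdiff_off (g : C -> C) (z L w : C) : w != z ->
  exists2 d : R, 0 < d & forall h, cabs h < d -> (g (w + h) - g z) / (w + h - z) = divdiff g z L (w + h).
Proof.
move=> wz; exists (cabs (w - z)); first by rewrite cabs_gt0 subr_eq0.
move=> h hh; rewrite /divdiff ifN //; apply/eqP => e; move: hh.
by rewrite -e opprD addrA subrr sub0r cabsN ltxx.
Qed.

Lemma cderiv_subV (z w : C) : w != z -> cderiv (fun u => (u - z)^-1) w (- (w - z) ^- 2 * (1 + 0)).
Proof.
move=> wz; apply: (@cderivV _ (fun u => u - z)); first by rewrite subr_eq0.
by apply: cderivD; [exact: cderiv_id|exact: cderiv_cst].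
Qed.

Lemma ccont_divdiff (g : C -> C) (z L w : C) : w != z -> ccont g w -> ccont (divdiff g z L) w.
Proof.
move=> wz cg; have [d d0 hd] := divdiff_off g L wz.
apply: (@ccont_ext R (fun u => (g u - g z) * (u - z)^-1) _ w d d0 hd); apply: ccontM; last exact: cderiv_cont (cderiv_subV wz).
by apply: ccontD => //; exact: ccont_cst.
Qed.

Lemma cderiv_divdiff (g : C -> C) (z L w M : C) : w != z -> cderiv g w M ->
  exists N, cderiv (divdiff g z L) w N.
Proof.
move=> wz cg; have [d d0 hd] := divdiff_off g L wz; eexists.
apply: (@cderiv_ext R (fun u => (g u - g z) * (u - z)^-1) _ w _ d d0 hd); apply: cderivM; last exact: (cderiv_subV wz).
by apply: cderivD; [exact: cg|exact: cderiv_cst].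
Qed.

Lemma ccont_divdiff_at (g : C -> C) (z L : C) : cderiv g z L -> ccont (divdiff g z L) z.
Proof.
move=> H e e0; have [d d0 hd] := H e e0; exists d => // h hh.
rewrite /divdiff eqxx; case: ifPn => [|hz]; first by rewrite subrr cabs0 ltW.
have h0 : h != 0 by apply: contra hz => /eqP ->; rewrite addr0.
have := hd h hh; rewrite -ler_pdivrMr ?cabs_gt0 // -cabsV -cabsM.
have -> // : (g (z + h) - g z - L * h) / h = (g (z + h) - g z) / (z + h - z) - L.
by rewrite mulrBl mulfK // [z + h]addrC addrK.
Qed.

Variables (r : R) (r0 : 0 < r).
Implicit Types (q : C -> C) (z : C).

Lemma circ_neq z y : cabs z < r -> circ r y != z.
Proof. by move=> hz; apply: contraTneq hz => <-; rewrite cabs_circ // ltxx. Qed.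

Lemma cabs_circ_sub z y : cabs z < r -> r - cabs z <= cabs (circ r y - z).
Proof. by move=> hz; rewrite -{1}(cabs_circ y r0); exact: ler_cabs_sub. Qed.

Definition cauchy_int q z : C := cint (fun y => circ r y * q (circ r y) / (circ r y - z)).

Lemma rcont_cauchy q z : (forall y, ccont q (circ r y)) -> cabs z < r ->
  rcont (fun y => circ r y * q (circ r y) / (circ r y - z)).
Proof.
move=> cq hz; apply: (@rcont_circ R r (fun w => w * q w / (w - z))) => y.
apply: ccontM; last exact: cderiv_cont (cderiv_subV (circ_neq y hz)).
by apply: ccontM => //; exact: cderiv_cont (cderiv_id _).
Qed.

(** [cauchy_circle] is applied to the divided difference of [q] at [z], with [z] added to the
    exceptional points. The integral of the kernel, in truth 2 pi, stays unevaluated; the lower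
    bound [cauchy_int1_gt] is enough. *)
Lemma cauchy_formula q (r' : R) (S : seq C) z : r < r' ->
  (forall w, cabs w < r' -> ccont q w) ->
  (forall w, cabs w < r' -> w \notin S -> exists L, cderiv q w L) ->
  cabs z < r -> z \notin S ->
  cauchy_int q z = q z * cauchy_int (fun=> 1) z.
Proof.
move=> rr' cq dq hz zS; have hz' := lt_trans hz rr'.
have [L HL] := dq z hz' zS.
have H := @cauchy_circle R (divdiff q z L) r r' (z :: S) r0 rr'.
have cqc y : ccont q (circ r y) by apply: cq; rewrite cabs_circ.
rewrite /cauchy_int -(@cintZ R); last exact: (@rcont_cauchy (fun=> 1) z (fun y => ccont_cst _ _) hz).
apply/eqP; rewrite -subr_eq0 -[- cint _]mulN1r -(@cintZ R); last first.
  apply: (@rcont_circ R r (fun w => q z * (w * 1 / (w - z)))) => y.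
  apply: ccontM; first exact: ccont_cst.
  apply: ccontM; last exact: cderiv_cont (cderiv_subV (circ_neq y hz)).
  by apply: ccontM; [exact: cderiv_cont (cderiv_id _)|exact: ccont_cst].
rewrite -(@cintD R); first last.
- apply: (@rcont_circ R r (fun w => -1 * (q z * (w * 1 / (w - z))))) => y.
  apply: ccontM; first exact: ccont_cst.
  apply: ccontM; first exact: ccont_cst.
  apply: ccontM; last exact: cderiv_cont (cderiv_subV (circ_neq y hz)).
  by apply: ccontM; [exact: cderiv_cont (cderiv_id _)|exact: ccont_cst].
- exact: rcont_cauchy.
rewrite (_ : (fun y => _) = (fun y => circ r y * divdiff q z L (circ r y))); last first.
  apply/funext => y; rewrite /divdiff ifN ?circ_neq //; field.
  by rewrite subr_eq0 circ_neq.
apply/eqP; apply: H => w hw.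
  have [->|wz] := eqVneq w z; first exact: ccont_divdiff_at.
  by apply: ccont_divdiff => //; exact: cq.
rewrite inE negb_or => /andP[wz wS]; have [M HM] := dq w hw wS.
exact: cderiv_divdiff HM.
Qed.

(** The quotient is 1 / (1 - u) with u = z / w in the unit disc, and this map sends the disc into
    the half-plane Re > 1/2. *)
Lemma Re_kernel (w z : C) : cabs z < cabs w -> 2^-1 <= complex.Re (w / (w - z)).
Proof.
move=> h.
have h2 : cabs z ^+ 2 < cabs w ^+ 2 by rewrite ltr_pXn2r ?nnegrE ?cabs_ge0.
have wz : 0 < cabs (w - z) ^+ 2.
  rewrite exprn_gt0 // cabs_gt0 subr_eq0; apply: contraTneq h => ->; by rewrite ltxx.
move: h2 wz; rewrite !sqr_cabs ReB ImB; case: w {h} => a b; case: z => c d /=.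
set s := (a - c) ^+ 2 + _ => h s0.
rewrite (_ : _ - _ = (a * (a - c) + b * (b - d)) / s); last by field; rewrite gt_eqF.
rewrite ler_pdivlMr // /s; move: h; nra.
Qed.

Lemma cauchy_int1_gt z : cabs z < r -> T / 2 <= cabs (cauchy_int (fun=> 1) z).
Proof.
move=> hz; have T0 := @T_gt0 R.
apply: le_trans (le_trans (ler_norm _) (Re_le_cabs _)).
have [c1 _] := rcontP (@rcont_cauchy (fun=> 1) z (fun y => ccont_cst _ _) hz).
have [M M0 HM] := rcont_bounded (@rcont_cauchy (fun=> 1) z (fun y => ccont_cst _ _) hz).
(* The real part of the kernel lies in [1/2, M]; the constants are the centre and the half-length of
   this interval. *)
have := rint_close (c := (2^-1 + M) / 2) (e := (M - 2^-1) / 2) c1.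
rewrite /cauchy_int /= ler_norml => H.
have /andP[h1 _] : - ((M - 2^-1) / 2 * T) <= rint (fun y : R => complex.Re (circ r y * 1 / (circ r y - z))) - (2^-1 + M) / 2 * T <=
    (M - 2^-1) / 2 * T.
  apply: H => y hy; rewrite ler_norml mulr1.
  have := Re_kernel (w := circ r y) (z := z); rewrite cabs_circ // => /(_ hz) a1.
  have := HM y hy; rewrite mulr1 => a2; have := le_trans (ler_norm _) (Re_le_cabs (circ r y / (circ r y - z))).
  by lra.
move: h1; lra.
Qed.

Lemma cauchy_int_le q z M : (forall y, ccont q (circ r y)) -> cabs z < r ->
  (forall w, cabs w = r -> cabs (q w) <= M) ->
  cabs (cauchy_int q z) <= 2 * T * (r * M / (r - cabs z)).
Proof.
move=> cq hz bq; apply: cint_le; first exact: rcont_cauchy.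
move=> y _; rewrite !cabsM cabsV cabs_circ //; apply: ler_pM.
- by rewrite mulr_ge0 ?cabs_ge0 // ltW.
- by rewrite invr_ge0 cabs_ge0.
- by rewrite ler_wpM2l ?(ltW r0) // bq // cabs_circ.
- rewrite lef_pV2 ?posrE ?subr_gt0 // ?cabs_circ_sub //.
  by rewrite cabs_gt0 subr_eq0 circ_neq.
Qed.

(** Differentiation under the integral sign: subtracting the linear term from the increment of 1 /
    (u - z) leaves h^2 / ((u - z - h) (u - z)^2), which is uniformly O(h^2) when z and z + h stay at
    distance [del] from the circle. *)
Lemma cderiv_cauchy_int q z : (forall y, ccont q (circ r y)) -> cabs z < r ->
  exists L, cderiv (cauchy_int q) z L.
Proof.
move=> cq hz; exists (cint (fun y => circ r y * q (circ r y) / (circ r y - z) ^+ 2)).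
have [M M0 HM] := rcont_bounded (rcont_circ cq).
pose del := (r - cabs z) / 2.
have del0 : 0 < del by rewrite divr_gt0 // subr_gt0.
have T0 := @T_gt0 R.
pose B := 2 * T * (r * M / (del * del ^+ 2)).
have B0 : 0 < B.
  apply: mulr_gt0; first by apply: mulr_gt0; [exact: ltr0n|exact: T0].
  by apply: divr_gt0; [exact: mulr_gt0|rewrite mulr_gt0 ?exprn_gt0].
move=> e e0; exists (Num.min del (e / B)); first by rewrite lt_min del0 divr_gt0.
move=> h; rewrite lt_min => /andP[h1 h2].
have hzh : cabs (z + h) < r.
  by apply: le_lt_trans (ler_cabsD _ _) _; move: h1; rewrite /del; lra.
have cq2 : rcont (fun y => circ r y * q (circ r y) / (circ r y - z) ^+ 2).
  apply: (@rcont_circ R r (fun w => w * q w / (w - z) ^+ 2)) => y.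
  apply: ccontM; first by apply: ccontM => //; exact: cderiv_cont (cderiv_id _).
  have E : (fun w : C => ((w - z) ^+ 2)^-1) = (fun w => (w - z)^-1 * (w - z)^-1).
    by apply/funext => w; rewrite expr2 invfM.
  by rewrite E; apply: ccontM; exact: cderiv_cont (cderiv_subV (circ_neq y hz)).
have kap y : circ r y - z != 0 by rewrite subr_eq0 circ_neq.
have kap' y : circ r y - (z + h) != 0 by rewrite subr_eq0 circ_neq.
pose G y := circ r y * q (circ r y) / (circ r y - (z + h)).
have cG : rcont G by exact: rcont_cauchy.
pose F y := circ r y * q (circ r y) / (circ r y - z).
have cF : rcont F by exact: rcont_cauchy.
have cc (A : R -> C) c : rcont A -> rcont (fun y => c * A y).
  move=> cA t e' e'0.
  have [|d d0 hd] := cA t (e' / (1 + cabs c)); first by rewrite divr_gt0 // ltr_pwDl ?cabs_ge0.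
  exists d => // s /hd; rewrite ler_pdivlMr ?ltr_pwDl ?cabs_ge0 // => l.
  rewrite -mulrBr cabsM; apply: le_trans l; rewrite mulrC ler_wpM2l ?cabs_ge0 //; lra.
have ca (A A' : R -> C) : rcont A -> rcont A' -> rcont (fun y => A y + A' y).
  move=> cA cA' t e' e'0.
  have e'2 : 0 < e' / 2 by rewrite divr_gt0.
  have [d d0 hd] := cA t _ e'2; have [d' d'0 hd'] := cA' t _ e'2.
  exists (Num.min d d'); first by rewrite lt_min d0.
  move=> s; rewrite lt_min => /andP[/hd l1 /hd' l2].
  rewrite (_ : _ - _ = (A s - A t) + (A' s - A' t)); last by ring.
  by apply: le_trans (ler_cabsD _ _) _; lra.
rewrite -[cauchy_int q (z + h)]/(cint G) -[cauchy_int q z]/(cint F).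
rewrite -[- cint _]mulN1r -(@cintZ R) // -(@cintD R) //; last exact: cc.
rewrite [_ * h]mulrC -mulNr -(@cintZ R) // -(@cintD R); last exact: cc.
  apply: le_trans (cint_le (M := r * M * (cabs h * cabs h) / (del * del ^+ 2)) _ _) _.
  - by apply: (ca); [apply: (ca) => //|]; exact: cc.
  - move=> y hy.
    rewrite (_ : _ + _ = circ r y * q (circ r y) * (h * h) / ((circ r y - (z + h)) * (circ r y - z) ^+ 2)); last first.
      by rewrite /G /F; field; rewrite kap kap'.
    rewrite !cabsM cabsV cabsM cabsX cabs_circ //.
    have l1 : del <= cabs (circ r y - (z + h)).
      apply: le_trans (cabs_circ_sub y hzh); have := ler_cabsD z h; rewrite /del in h1 *; lra.
    have l2 : del <= cabs (circ r y - z).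
      apply: le_trans (cabs_circ_sub y hz); rewrite /del; have := subr_gt0 (cabs z) r; rewrite hz; lra.
    apply: ler_pM.
    + by rewrite !mulr_ge0 ?cabs_ge0 // ltW.
    + by rewrite invr_ge0 mulr_ge0 ?exprn_ge0 ?cabs_ge0.
    + apply: ler_pM; rewrite ?mulr_ge0 ?cabs_ge0 ?(ltW r0) //.
      by apply: ler_pM; rewrite ?cabs_ge0 ?(ltW r0) // HM.
    + rewrite lef_pV2 ?posrE; last 2 first.
      * by rewrite mulr_gt0 ?exprn_gt0 // cabs_gt0.
      * by rewrite mulr_gt0 ?exprn_gt0.
      apply: ler_pM; rewrite ?exprn_ge0 ?(ltW del0) //.
      by rewrite lerXn2r ?nnegrE ?cabs_ge0 ?(ltW del0).
  rewrite (_ : 2 * T * _ = cabs h * B * cabs h); last by rewrite /B; field; rewrite gt_eqF.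
  by apply: ler_wpM2r; [exact: cabs_ge0|apply: ltW; move: h2; rewrite ltr_pdivlMr].
by apply: ca => //; exact: cc.
Qed.

End CauchyFormula.

(** * Removable singularities and the maximum principle *)

Section Holomorphic.
Variable R : realType.
Local Notation C := (R[i])%C.
Local Notation T := (pi *+ 2 : R).
Implicit Types (q g : C -> C) (z : C).

(** Away from [s] Cauchy's formula writes [q] as a quotient of two Cauchy integrals, which is
    differentiable at [s] as well; by continuity [q] agrees with it there. *)
Lemma removable_singularity q (r' : R) s : cabs s < r' ->
  (forall w, cabs w < r' -> ccont q w) ->
  (forall w, cabs w < r' -> w != s -> exists L, cderiv q w L) ->
  exists L, cderiv q s L.
Proof.
move=> hs cq dq; have s0 := cabs_ge0 s.
pose r := (cabs s + r') / 2.
have r0 : 0 < r by rewrite /r; lra.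
have rr' : r < r' by rewrite /r; lra.
have sr : cabs s < r by rewrite /r; lra.
have cqc y : ccont q (circ r y) by apply: cq; rewrite cabs_circ.
have c1c y : ccont (fun=> 1 : C) (circ r y) by exact: ccont_cst.
pose N := cauchy_int r q; pose K := cauchy_int r (fun=> 1).
have Kn0 z : cabs z < r -> K z != 0.
  by move=> hz; rewrite -cabs_gt0 (lt_le_trans _ (cauchy_int1_gt r0 hz)) // divr_gt0 ?T_gt0.
have off z : cabs z < r -> z != s -> q z = N z / K z.
  move=> hz zs; rewrite /N (@cauchy_formula _ _ r0 q r' [:: s] z) ?inE //.
    by rewrite mulfK // Kn0.
  by move=> w hw; rewrite inE; exact: dq.
have [LN HN] := cderiv_cauchy_int r0 cqc sr.
have [LK HK] := cderiv_cauchy_int r0 c1c sr.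
have HD := cderivM HN (cderivV (Kn0 s sr) HK).
have d0 : 0 < r - cabs s by rewrite subr_gt0.
have near h : cabs h < r - cabs s -> cabs (s + h) < r.
  by move=> hh; apply: le_lt_trans (ler_cabsD _ _) _; lra.
have at_s : q s = N s / K s.
  have [d1 d10 h1] : exists2 d, 0 < d & forall h, cabs h < d -> h != 0 -> q (s + h) = N (s + h) / K (s + h).
    exists (r - cabs s) => // h hh h0; apply: off; first exact: near.
    by apply: contra h0 => /eqP e; rewrite -(addrK s h) [h + s]addrC e subrr.
  apply/eqP; rewrite -subr_eq0 -cabs_eq0 eq_le cabs_ge0 andbT.
  apply/ler_addgt0Pl => e e0; rewrite addr0.
  have e2 : 0 < e / 2 by rewrite divr_gt0.
  have [d2 d20 h2] := cq s hs _ e2; have [d3 d30 h3] := cderiv_cont HD e2.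
  pose m := Num.min d1 (Num.min d2 d3); have m0 : 0 < m by rewrite !lt_min d10 d20.
  pose h := (m / 2)%:C.
  have ch : cabs h = m / 2 by rewrite cabs_real ger0_norm // divr_ge0 // ltW.
  have hm : cabs h < m by rewrite ch; lra.
  move: (hm); rewrite !lt_min => /and3P[l1 l2 l3].
  have h0 : h != 0 by rewrite -cabs_gt0 ch divr_gt0.
  have {}h1 := h1 h l1 h0; have {}h2 := h2 h l2; have {}h3 := h3 h l3.
  rewrite (_ : q s - N s / K s = - (q (s + h) - q s) + (N (s + h) / K (s + h) - N s / K s)); last first.
    by rewrite h1; ring.
  by apply: le_trans (ler_cabsD _ _) _; rewrite cabsN; lra.
eexists; apply: (@cderiv_ext R (fun w => N w * (K w)^-1) q s _ (r - cabs s) d0 _ HD) => h hh.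
have [->|h0] := eqVneq h 0; first by rewrite addr0 at_s.
apply/esym; apply: off; first exact: near.
by apply: contra h0 => /eqP e; rewrite -(addrK s h) [h + s]addrC e subrr.
Qed.

Lemma bernoulli_ineq (x : R) n : 0 <= x -> 1 + n%:R * x <= (1 + x) ^+ n.
Proof.
move=> x0; elim: n => [|n IH]; first by rewrite mul0r addr0 expr0.
rewrite exprS; apply: le_trans (_ : _ <= (1 + x) * (1 + n%:R * x)) _; last first.
  by rewrite ler_wpM2l // addr_ge0.
have : 0 <= n%:R * (x * x) by rewrite !mulr_ge0.
rewrite -[n.+1]addn1 natrD; lra.
Qed.

(* Landau's trick: the crude Cauchy bound with a constant c, applied to the powers of q,
   yields the maximum principle with constant 1. *)
Lemma maximum_principle q (r r' M : R) z : 0 < r -> r < r' -> 0 < M ->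
  (forall w, cabs w < r' -> exists L, cderiv q w L) ->
  (forall w, cabs w = r -> cabs (q w) <= M) -> cabs z < r -> cabs (q z) <= M.
Proof.
move=> r0 rr' M0 dq bq hz; have T0 := @T_gt0 R.
have dqn n w : cabs w < r' -> exists L, cderiv (fun u => q u ^+ n) w L.
  move=> hw; elim: n => [|n [L HL]]; first by exists 0; exact: cderiv_cst.
  have [L1 HL1] := dq w hw; eexists.
  rewrite (_ : (fun u => _) = (fun u => q u * q u ^+ n)); last by apply/funext => u; rewrite exprS.
  exact: cderivM HL1 HL.
have cqn n w : cabs w < r' -> ccont (fun u => q u ^+ n) w.
  by move=> /(dqn n) [L]; exact: cderiv_cont.
pose c := 4 * r / (r - cabs z).
have rz : 0 < r - cabs z by rewrite subr_gt0.
have crude n : cabs (q z) ^+ n <= c * M ^+ n.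
  have cc y : ccont (fun u => q u ^+ n) (circ r y) by apply: cqn; rewrite cabs_circ.
  have hle : cabs (cauchy_int r (fun u => q u ^+ n) z) <= 2 * T * (r * M ^+ n / (r - cabs z)).
    by apply: cauchy_int_le => // w hw; rewrite cabsX lerXn2r ?nnegrE ?cabs_ge0 ?(ltW M0) // bq.
  have := @cauchy_formula _ _ r0 (fun u => q u ^+ n) r' [::] z rr' (cqn n) (fun w hw _ => dqn n w hw) hz isT.
  move=> E; rewrite E cabsM cabsX in hle.
  have K2 := cauchy_int1_gt r0 hz.
  have : cabs (q z) ^+ n * (T / 2) <= 2 * T * (r * M ^+ n / (r - cabs z)).
    by apply: le_trans hle; rewrite ler_wpM2l ?exprn_ge0 ?cabs_ge0.
  rewrite -ler_pdivlMr ?divr_gt0 // => h; apply: le_trans h _.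
  rewrite le_eqVlt /c; apply/orP; left; apply/eqP; move: (pi *+ 2) T0 => t t0 ; field.
  by rewrite !gt_eqF.
(* If |q z| > M, the powers of |q z| / M grow at least linearly by Bernoulli's inequality and cannot
   stay below [c]. *)
rewrite leNgt; apply/negP => Mq.
pose x := cabs (q z) / M - 1.
have x0 : 0 < x by rewrite subr_gt0 ltr_pdivlMr // mul1r.
have ub n : 1 + n%:R * x <= c.
  apply: le_trans (bernoulli_ineq n (ltW x0)) _.
  by rewrite /x addrCA subrr addr0 expr_div_n ler_pdivrMr ?exprn_gt0.
have := ub (Num.bound (c / x)).
have c0 : 0 < c by rewrite divr_gt0 // mulr_gt0.
have : c / x < (Num.bound (c / x))%:R by apply: archi_boundP; rewrite divr_ge0 // ltW.
rewrite ltr_pdivrMr //; lra.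
Qed.

Lemma holomorphic_division g (r' : R) s L : cabs s < r' ->
  (forall w, cabs w < r' -> exists L, cderiv g w L) -> cderiv g s L ->
  forall w, cabs w < r' -> exists N, cderiv (divdiff g s L) w N.
Proof.
move=> hs dg HL w hw; have [->|ws] := eqVneq w s; last first.
  by have [M HM] := dg w hw; exact: cderiv_divdiff HM.
apply: (removable_singularity hs) => u hu.
  have [->|us] := eqVneq u s; first exact: ccont_divdiff_at.
  by have [M HM] := dg u hu; apply: ccont_divdiff => //; exact: cderiv_cont HM.
by move=> us; have [M HM] := dg u hu; exact: cderiv_divdiff HM.
Qed.

End Holomorphic.

(** * Blaschke factors and the Schwarz-Pick lemma *)

Section Blaschke.
Variable R : realType.
Local Notation C := (R[i])%C.
Implicit Types (p z w u v : C).

(** The involutive automorphism of the disc that exchanges 0 and [p]. *)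
Definition blas p z : C := (p - z) / (1 - conjc p * z).

Lemma cabs_conj z : cabs (conjc z) = cabs z.
Proof. by case: z => a b; rewrite /cabs /Normc.normc /= sqrrN. Qed.

Lemma blas_den_ge p z : 1 - cabs p * cabs z <= cabs (1 - conjc p * z).
Proof. by rewrite -{1}(@cabs1 R) -(cabs_conj p) -cabsM ler_cabs_sub. Qed.

Lemma blas_den_le p z : cabs (1 - conjc p * z) <= 1 + cabs p * cabs z.
Proof. by apply: le_trans (ler_cabsB _ _) _; rewrite cabs1 cabsM cabs_conj. Qed.

Lemma blas_den_gt0 p z : cabs p < 1 -> cabs z <= 1 -> 0 < cabs (1 - conjc p * z).
Proof.
move=> hp hz; apply: lt_le_trans (blas_den_ge p z).
rewrite subr_gt0 (le_lt_trans _ hp) // ler_piMr ?cabs_ge0 //.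
Qed.

Lemma blas_den_neq0 p z : cabs p < 1 -> cabs z <= 1 -> 1 - conjc p * z != 0.
Proof. by move=> hp hz; rewrite -cabs_gt0 blas_den_gt0. Qed.

Lemma blas_num_den p z : cabs (1 - conjc p * z) ^+ 2 - cabs (p - z) ^+ 2 =
  (1 - cabs p ^+ 2) * (1 - cabs z ^+ 2).
Proof. by rewrite !sqr_cabs; case: p z => a b [c d] /=; ring. Qed.

Lemma cabs_blas_sqr p z : cabs p < 1 -> cabs z <= 1 ->
  cabs (blas p z) ^+ 2 = 1 - (1 - cabs p ^+ 2) * (1 - cabs z ^+ 2) / cabs (1 - conjc p * z) ^+ 2.
Proof.
move=> hp hz; have d0 := blas_den_gt0 hp hz.
by rewrite -blas_num_den /blas cabsM cabsV; field; rewrite gt_eqF.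
Qed.

Lemma sqr_lt1 (x : R) : 0 <= x -> (x ^+ 2 < 1) = (x < 1).
Proof. by move=> x0; rewrite -[in LHS](expr1n _ 2) ltr_pXn2r ?nnegrE. Qed.

Lemma cabs_blas_lt1 p z : cabs p < 1 -> cabs z < 1 -> cabs (blas p z) < 1.
Proof.
move=> hp hz; rewrite -sqr_lt1 ?cabs_ge0 // cabs_blas_sqr // ?(ltW hz) //.
rewrite ltrBlDr ltrDl divr_gt0 ?exprn_gt0 ?(blas_den_gt0 hp (ltW hz)) //.
by rewrite mulr_gt0 // subr_gt0 sqr_lt1 ?cabs_ge0.
Qed.

(** The right-hand side is the value for points on opposite radii, where the denominator in
    [cabs_blas_sqr] is largest. *)
Lemma cabs_blas_le p z : cabs p < 1 -> cabs z <= 1 ->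
  cabs (blas p z) <= (cabs p + cabs z) / (1 + cabs p * cabs z).
Proof.
move=> hp hz; have d0 := blas_den_gt0 hp hz.
have p0 := cabs_ge0 p; have z0 := cabs_ge0 z.
have e0 : 0 < 1 + cabs p * cabs z by rewrite ltr_pwDl ?mulr_ge0.
rewrite -(@ler_pXn2r _ 2) ?nnegrE ?cabs_ge0 ?divr_ge0 ?addr_ge0 ?(ltW e0) //.
rewrite cabs_blas_sqr // lerBlDr -lerBlDl.
rewrite (_ : 1 - _ = (1 - cabs p ^+ 2) * (1 - cabs z ^+ 2) / (1 + cabs p * cabs z) ^+ 2); last first.
  by field; rewrite gt_eqF.
rewrite ler_wpM2l ?mulr_ge0 ?subr_ge0 ?expr_le1 ?(ltW hp) //.
rewrite lef_pV2 ?posrE ?exprn_gt0 // lerXn2r ?nnegrE ?(ltW d0) ?(ltW e0) //.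
  exact: blas_den_le.
exact: mulr_ge0.
Qed.

Lemma blas0 p : blas p 0 = p.
Proof. by rewrite /blas mulr0 !subr0 divr1. Qed.

Lemma blas0l z : blas 0 z = - z.
Proof. by rewrite /blas conjc0 mul0r subr0 divr1 sub0r. Qed.

Lemma blasxx p : blas p p = 0.
Proof. by rewrite /blas subrr mul0r. Qed.

Lemma conj_blas p z : conjc (blas p z) = (conjc p - conjc z) / (1 - p * conjc z).
Proof. by rewrite /blas rmorphM fmorphV !rmorphB rmorph1 rmorphM /= conjcK. Qed.

Lemma conj_den_neq0 p z : cabs p < 1 -> cabs z <= 1 -> 1 - p * conjc z != 0.
Proof. by move=> hp hz; have := @blas_den_neq0 (conjc p) (conjc z); rewrite !cabs_conj conjcK; apply. Qed.

Lemma blasK p z : cabs p < 1 -> cabs z < 1 -> blas p (blas p z) = z.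
Proof.
move=> hp hz.
have n1 := blas_den_neq0 hp (ltW hz).
have n3 := blas_den_neq0 hp (ltW hp).
rewrite /blas; move: (conjc p) n1 n3 => cp n1 n3; field; rewrite n1 /=.
by rewrite (_ : _ - _ - _ = 1 - cp * p) //; ring.
Qed.

(* [cabs (blas u v)] is the pseudo-hyperbolic distance of u and v. *)
Lemma blas_isometry p u v : cabs p < 1 -> cabs u < 1 -> cabs v < 1 ->
  cabs (blas (blas p u) (blas p v)) = cabs (blas u v).
Proof.
move=> hp hu hv.
have n1 := blas_den_neq0 hp (ltW hu); have n2 := blas_den_neq0 hp (ltW hv).
have n3 := conj_den_neq0 hp (ltW hu).
have n4 := blas_den_neq0 hu (ltW hv).
have n5 := blas_den_neq0 (cabs_blas_lt1 hp hu) (ltW (cabs_blas_lt1 hp hv)).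
have n6 := blas_den_neq0 hp (ltW hp).
(* The extra factor is a number of modulus 1, a quotient of two conjugates. *)
have -> : blas (blas p u) (blas p v) = - blas u v * ((1 - p * conjc u) / (1 - conjc p * u)).
  rewrite {1}/blas; have -> : 1 - conjc (blas p u) * blas p v =
      (1 - conjc p * p) * (1 - conjc u * v) / ((1 - p * conjc u) * (1 - conjc p * v)).
    rewrite conj_blas /blas; move: (conjc p) (conjc u) n2 n3 => cp cu n2 n3.
    by field; rewrite n2 n3.
  rewrite /blas; move: (conjc p) (conjc u) n1 n2 n3 n4 n6 => cp cu n1 n2 n3 n4 n6.
  by field; rewrite n1 n2 n3 n4 n6.
rewrite cabsM cabsN (_ : cabs ((1 - p * conjc u) / (1 - conjc p * u)) = 1) ?mulr1 //.
have -> : 1 - p * conjc u = conjc (1 - conjc p * u) by rewrite rmorphB rmorph1 rmorphM /= conjcK.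
by rewrite cabsM cabsV cabs_conj divff // cabs_eq0.
Qed.

Lemma cderiv_blas p z : cabs p < 1 -> cabs z <= 1 -> exists L, cderiv (blas p) z L.
Proof.
move=> hp hz; eexists; apply: cderivM.
  by apply: cderivD; [exact: cderiv_cst|apply: cderivN; exact: cderiv_id].
apply: cderivV; first exact: blas_den_neq0.
apply: cderivD; first exact: cderiv_cst.
by apply: cderivN; apply: cderivM; [exact: cderiv_cst|exact: cderiv_id].
Qed.

Definition hol (f : C -> C) := forall z, cabs z < 1 -> exists L, cderiv f z L.

Lemma hol_mul f g : hol f -> hol g -> hol (fun z => f z * g z).
Proof. by move=> hf hg z hz; have [L HL] := hf z hz; have [M HM] := hg z hz; eexists; exact: cderivM HL HM. Qed.
Lemma hol_add f g : hol f -> hol g -> hol (fun z => f z + g z).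
Proof. by move=> hf hg z hz; have [L HL] := hf z hz; have [M HM] := hg z hz; eexists; exact: cderivD HL HM. Qed.
Lemma hol_cst c : hol (fun=> c).
Proof. by move=> z _; exists 0; exact: cderiv_cst. Qed.
Lemma hol_id : hol id.
Proof. by move=> z _; exists 1; exact: cderiv_id. Qed.
Lemma hol_comp f g : hol f -> (forall z, cabs z < 1 -> cabs (f z) < 1) -> hol g -> hol (fun z => g (f z)).
Proof. by move=> hf fD hg z hz; have [L HL] := hf z hz; have [M HM] := hg _ (fD z hz); eexists; exact: cderiv_comp HL HM. Qed.
Lemma hol_blas p : cabs p < 1 -> hol (blas p).
Proof. by move=> hp z /ltW; exact: cderiv_blas. Qed.

Lemma cderiv_blas_comp f (x L : C) : cabs (f x) < 1 -> cderiv f x L ->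
  exists M, cderiv (fun z => blas (f x) (f z)) x (M * L).
Proof. by move=> fx HL; have [M HM] := cderiv_blas fx (ltW fx); exists M; exact: cderiv_comp HL HM. Qed.

(** The quotient by a Blaschke factor is bounded by 1 because that factor has modulus close to 1 on
    circles close to the unit circle. The last conclusion allows a second division at a double
    zero. *)
Lemma blaschke_division (g : C -> C) (x L : C) : hol g -> (forall z, cabs z < 1 -> cabs (g z) <= 1) ->
  cabs x < 1 -> g x = 0 -> cderiv g x L ->
  exists k, [/\ hol k, forall z, cabs z < 1 -> cabs (k z) <= 1,
    forall z, cabs z < 1 -> g z = blas x z * k z & L = 0 -> k x = 0].
Proof.
move=> hg gD hx gx HL; pose d := divdiff g x L.
have hd : hol d by apply: (holomorphic_division hx).
pose k z := (conjc x * z + (-1)) * d z.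
have hk : hol k.
  by apply: hol_mul => //; apply: hol_add; [apply: hol_mul; [exact: hol_cst|exact: hol_id]|exact: hol_cst].
have gk z : cabs z < 1 -> g z = blas x z * k z.
  move=> hz; have n1 := blas_den_neq0 hx (ltW hz).
  rewrite /blas /k /d /divdiff; case: eqP => [->|/eqP zx]; first by rewrite gx subrr !mul0r.
  by rewrite gx; field; rewrite n1 subr_eq0 zx.
exists k; split => //; last by move=> L0; rewrite /k /d /divdiff eqxx L0 mulr0.
move=> z hz; apply/ler_addgt0Pl => e e0; rewrite addrC.
pose P := cabs x; have P0 : 0 <= P := cabs_ge0 x.
have hP : 0 < 1 - P by rewrite subr_gt0.
pose kap := 1 - (1 + e)^-1 ^+ 2.
have e1 : 0 < 1 + e by rewrite ltr_wpDr // ltW.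
have kap0 : 0 < kap.
  by rewrite subr_gt0 sqr_lt1 ?invr_ge0 ?(ltW e1) // invf_lt1 // ltrDl.
have Z0 := cabs_ge0 z.
(* On |w| = 1 - del the defect 1 - |blas x w|^2 is at most 2 del / (1 - P)^2 <= kap, so |blas x w|
   >= 1 / (1 + e). The second term of the minimum keeps [z] inside this circle. *)
pose del := Num.min ((1 - P) ^+ 2 * kap / 2) ((1 - cabs z) / 2).
have del0 : 0 < del.
  rewrite lt_min; apply/andP; split; apply: divr_gt0 => //; last by rewrite subr_gt0.
  by apply: mulr_gt0 => //; exact: exprn_gt0.
have [dl1 dl2] : del <= (1 - P) ^+ 2 * kap / 2 /\ del <= (1 - cabs z) / 2.
  by split; rewrite ge_min lexx ?orbT.
pose r := 1 - del.
have r0 : 0 < r by rewrite /r; lra.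
have r1 : r < 1 by rewrite /r; lra.
have zr : cabs z < r by rewrite /r; lra.
apply: (maximum_principle r0 r1 e1 hk _ zr) => w hw.
have w1 : cabs w < 1 by rewrite hw.
have := gD w w1; rewrite (gk w w1) cabsM => h1.
have bl : (1 + e)^-1 <= cabs (blas x w).
  rewrite -(@ler_pXn2r _ 2) ?nnegrE ?cabs_ge0 ?invr_ge0 ?(ltW e1) //.
  rewrite cabs_blas_sqr ?(ltW w1) // lerBrDr -lerBrDl -/kap.
  rewrite ler_pdivrMr ?exprn_gt0 ?(blas_den_gt0 hx (ltW w1)) //.
  have l1 : (1 - cabs x ^+ 2) * (1 - cabs w ^+ 2) <= 1 - cabs w ^+ 2.
    rewrite ler_piMl ?subr_ge0 ?expr_le1 ?cabs_ge0 ?(ltW w1) // lerBlDr lerDl exprn_ge0 ?cabs_ge0 //.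
  have l2 : 1 - cabs w ^+ 2 <= 2 * del by rewrite hw /r; nra.
  have l3 : (1 - P) ^+ 2 <= cabs (1 - conjc x * w) ^+ 2.
    rewrite lerXn2r ?nnegrE ?cabs_ge0 ?(ltW hP) //; apply: le_trans (blas_den_ge x w).
    by rewrite lerD2l lerN2 -/P ler_piMr // ltW.
  apply: le_trans l1 (le_trans l2 _); rewrite [leRHS]mulrC.
  have : (1 - P) ^+ 2 * kap <= cabs (1 - conjc x * w) ^+ 2 * kap by rewrite ler_wpM2r // ltW.
  by move: dl1; lra.
have : (1 + e)^-1 * cabs (k w) <= 1 by apply: le_trans h1; rewrite ler_wpM2r ?cabs_ge0.
by rewrite mulrC ler_pdivrMr // mul1r.
Qed.

Lemma schwarz_pick (f : C -> C) z w : hol f -> (forall u, cabs u < 1 -> cabs (f u) < 1) ->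
  cabs z < 1 -> cabs w < 1 -> cabs (blas (f w) (f z)) <= cabs (blas w z).
Proof.
move=> hf fD hz hw.
pose g u := blas (f w) (f u).
have hg : hol g by apply: (hol_comp hf fD); apply: hol_blas; exact: fD.
have [L HL] := hg w hw.
have [||k [hk kD gk _]] := blaschke_division hg _ hw _ HL.
- by move=> u hu; apply: ltW; apply: cabs_blas_lt1; exact: fD.
- by rewrite /g blasxx.
by rewrite -/(g z) gk // cabsM ler_piMr ?cabs_ge0 ?kD.
Qed.

Lemma schwarz (f : C -> C) z : hol f -> (forall u, cabs u < 1 -> cabs (f u) < 1) -> f 0 = 0 ->
  cabs z < 1 -> cabs (f z) <= cabs z.
Proof.
move=> hf fD f0 hz; have := schwarz_pick hf fD hz (w := 0).
by rewrite cabs0 f0 !blas0l !cabsN; apply.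
Qed.

(** A quantitative form of the maximum principle: if |k 0| is close to 1, then [k] is close to [k 0]
    on smaller discs. It follows from Schwarz-Pick at 0 after bounding the denominator by 1 - |k
    0|^2 + |k z - k 0|. *)
Lemma almost_constant (k : C -> C) z : hol k -> (forall u, cabs u < 1 -> cabs (k u) <= 1) ->
  cabs z < 1 -> cabs (k z - k 0) * (1 - cabs z) <= cabs z * (1 - cabs (k 0) ^+ 2).
Proof.
move=> hk kD hz; have Z0 := cabs_ge0 z.
have z01 : cabs (0 : C) < 1 by rewrite cabs0.
have k01 := kD 0 z01; have kz1 := kD z hz.
have c0 := cabs_ge0 (k 0).
suff key : cabs (k z - k 0) <= cabs z * cabs (1 - conjc (k 0) * k z).
  have : cabs (1 - conjc (k 0) * k z) <= (1 - cabs (k 0) ^+ 2) + cabs (k z - k 0).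
    have -> : 1 - conjc (k 0) * k z = (1 - conjc (k 0) * k 0) - conjc (k 0) * (k z - k 0) by ring.
    apply: le_trans (ler_cabsB _ _) _; apply: lerD.
      have -> : 1 - conjc (k 0) * k 0 = (1 - cabs (k 0) ^+ 2)%:C.
        by rewrite sqr_cabs; case: (k 0) => a b; apply/eqP; rewrite eq_complex /=; apply/andP; split; apply/eqP; ring.
      by rewrite cabs_real ger0_norm // subr_ge0 expr_le1.
    by rewrite cabsM cabs_conj ler_piMl ?cabs_ge0.
  move=> h; have := ler_wpM2l Z0 h; lra.
(* Schwarz-Pick needs values inside the open disc, so it is applied to (1 - t) k with small t. *)
apply/ler_addgt0Pl => e e0.
pose t := Num.min (1 / 2) (e / 4).
have t0 : 0 < t by rewrite lt_min; apply/andP; split; apply: divr_gt0.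
have [t1 t2] : t <= 1 / 2 /\ t <= e / 4 by split; rewrite ge_min lexx ?orbT.
pose f u := (1 - t)%:C * k u.
have th : cabs (1 - t)%:C = 1 - t by rewrite cabs_real ger0_norm //; lra.
have hf : hol f by apply: hol_mul => //; exact: hol_cst.
have fD u : cabs u < 1 -> cabs (f u) < 1.
  move=> /kD ku; rewrite /f cabsM th; have := ler_wpM2l (_ : 0 <= 1 - t) ku.
  by rewrite mulr1 => /(_ _) h; apply: le_lt_trans (h _) _; lra.
have := schwarz_pick hf fD hz z01.
rewrite blas0l cabsN /blas cabsM cabsV ler_pdivrMr; last first.
  by apply: blas_den_gt0; [exact: fD|apply: ltW; exact: fD].
have -> : f 0 - f z = - ((1 - t)%:C * (k z - k 0)) by rewrite /f; ring.
rewrite cabsN cabsM th => h.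
have h2 : cabs (1 - conjc (f 0) * f z) <= cabs (1 - conjc (k 0) * k z) + 2 * t.
  have -> : 1 - conjc (f 0) * f z = (1 - conjc (k 0) * k z) + (2 * t - t ^+ 2)%:C * (conjc (k 0) * k z).
    have cT x : conjc ((1 - t)%:C * x) = (1 - t)%:C * conjc x :> C.
      by rewrite rmorphM; congr (_ * _); exact: conjc_real.
    have -> : (2 * t - t ^+ 2)%:C = 1 - (1 - t)%:C * (1 - t)%:C :> C.
      by apply/eqP; rewrite eq_complex /=; apply/andP; split; apply/eqP; ring.
    by rewrite /f cT; move: (conjc (k 0)) ((1 - t)%:C) => c0' t'; ring.
  apply: le_trans (ler_cabsD _ _) _; rewrite lerD2l cabsM cabs_real.
  rewrite ger0_norm; last nra.
  have : cabs (conjc (k 0) * k z) <= 1 by rewrite cabsM cabs_conj mulr_ile1 ?cabs_ge0.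
  move=> h3; apply: le_trans (ler_wpM2l _ h3) _; nra.
have h4 : cabs (k z - k 0) <= 2 by apply: le_trans (ler_cabsB _ _) _; lra.
have h5 := ler_wpM2l Z0 h2.
have h6 : t * cabs (k z - k 0) <= t * 2 by rewrite ler_wpM2l // ltW.
have h7 : cabs z * t <= t by rewrite ler_piMl ?ltW.
lra.
Qed.

(** The vanishing derivative leaves a zero at [x] after the first division, so [blaschke_division]
    applies twice. *)
Lemma double_zero (f : C -> C) x : hol f -> (forall u, cabs u < 1 -> cabs (f u) < 1) ->
  cabs x < 1 -> cderiv f x 0 ->
  exists k, [/\ hol k, forall z, cabs z < 1 -> cabs (k z) <= 1 &
    forall z, cabs z < 1 -> blas (f x) (f z) = blas x z ^+ 2 * k z].
Proof.
move=> hf fD hx Hx; pose g u := blas (f x) (f u).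
have hg : hol g by apply: (hol_comp hf fD); apply: hol_blas; exact: fD.
have [M] := cderiv_blas_comp (fD x hx) Hx; rewrite mulr0 => HL.
have [||k [hk kD gk kx]] := blaschke_division hg _ hx _ HL.
- by move=> u hu; apply: ltW; apply: cabs_blas_lt1; exact: fD.
- by rewrite /g blasxx.
have [N HN] := hk x hx.
have [k2 [hk2 k2D gk2 _]] := blaschke_division hk kD hx (kx erefl) HN.
exists k2; split => // z hz.
by rewrite -/(g z) gk // gk2 // expr2 mulrA.
Qed.

End Blaschke.

(** * Lower bounds *)

Section LowerBounds.
Variable R : realType.
Local Notation C := (R[i])%C.
Implicit Types (f : C -> C) (c x y z : C).

Definition self_map f := hol f /\ forall u, cabs u < 1 -> cabs (f u) < 1.

Lemma two_zeros f x y : self_map f -> cabs x < 1 -> cabs y < 1 -> x != y ->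
  f x = 0 -> f y = 0 -> cabs (f 0) <= cabs x * cabs y.
Proof.
move=> [hf fD] hx hy xy fx fy; have z1 : cabs (0 : C) < 1 by rewrite cabs0.
have [L HL] := hf x hx.
have [k [hk kD fk _]] := blaschke_division hf (fun z hz => ltW (fD z hz)) hx fx HL.
have bxy : blas x y != 0.
  by apply: mulf_neq0; [rewrite subr_eq0|rewrite invr_eq0 blas_den_neq0 // ltW].
have ky : k y = 0.
  by have := fk y hy; rewrite fy => /esym /eqP; rewrite mulf_eq0 (negbTE bxy) => /eqP.
have [M HM] := hk y hy.
have [k2 [_ k2D kk2 _]] := blaschke_division hk kD hy ky HM.
rewrite fk // kk2 // !blas0 !cabsM ler_wpM2l ?cabs_ge0 // ler_piMr ?cabs_ge0 //.
exact: k2D.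
Qed.

Lemma cabs_blas_opp c : cabs (blas c (- c)) = 2 * cabs c / (1 + cabs c ^+ 2).
Proof.
have -> : blas c (- c) = (2%:C * c) / (1 + cabs c ^+ 2)%:C.
  rewrite /blas; congr (_ / _); first by case: (c) => a b; apply/eqP; rewrite eq_complex /=; apply/andP; split; apply/eqP; ring.
  rewrite sqr_cabs; case: c => a b; apply/eqP; rewrite eq_complex /=; apply/andP; split; apply/eqP; ring.
by rewrite !cabsM cabsV !cabs_real !ger0_norm // ?addr_ge0 ?sqr_ge0.
Qed.

Lemma double_point f c x : self_map f -> cabs x < 1 -> f 0 = 0 -> f x = c -> cderiv f x 0 ->
  exists k, [/\ hol k, forall z, cabs z < 1 -> cabs (k z) <= 1,
    forall z, cabs z < 1 -> blas c (f z) = blas x z ^+ 2 * k z &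
    cabs c = cabs x ^+ 2 * cabs (k 0)].
Proof.
move=> [hf fD] hx f0 <- Hx; have [k [hk kD fk]] := double_zero hf fD hx Hx.
have z1 : cabs (0 : C) < 1 by rewrite cabs0.
exists k; split => //; have := fk 0 z1; rewrite f0 !blas0 => {1}->.
by rewrite cabsM cabsX.
Qed.

(** At the extreme values x = s, y = s^2 the last hypothesis fails by the factor [lam], for then (x
    + y) / (1 + x y) = s / (1 - s + s^2). Hence x + y >= lam (s + s^2), and one of x >= lam s, y >=
    lam s^2 must hold. *)
Let real_aVb0 (A s lam x y : R) : 0 < s -> s < 1 -> A = s ^+ 2 ->
  lam ^+ 2 = 2 * (1 - s + s ^+ 2) ^+ 2 / (1 + s ^+ 4) -> 1 < lam ->
  s <= x -> A <= y -> 2 * A / (1 + A ^+ 2) <= ((x + y) / (1 + x * y)) ^+ 2 ->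
  lam * A ^+ 2 <= x ^+ 2 * y.
Proof.
move=> s0 s1 -> lamE lam1 sx sy h.
have x0 : 0 < x by apply: lt_le_trans sx.
have s20 : 0 < s ^+ 2 by rewrite exprn_gt0.
have y0 : 0 < y by apply: lt_le_trans sy.
have xy : s * s ^+ 2 <= x * y by apply: ler_pM => //; rewrite ltW.
have lam0 : 0 < lam by apply: lt_trans lam1.
have sum : lam * (s + s ^+ 2) <= x + y.
  rewrite -(@ler_pXn2r _ 2) ?nnegrE ?addr_ge0 ?mulr_ge0 ?addr_ge0 ?(ltW x0) ?(ltW y0) ?(ltW s0) ?(ltW s20) ?(ltW lam0) //.
  have d0 : 0 < 1 + x * y by rewrite addr_gt0 ?mulr_gt0.
  move: h; rewrite expr_div_n ler_pdivlMr ?exprn_gt0 // => h; apply: le_trans h.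
  have e : (lam * (s + s ^+ 2)) ^+ 2 = 2 * s ^+ 2 / (1 + (s ^+ 2) ^+ 2) * (1 + s * s ^+ 2) ^+ 2.
    rewrite exprMn lamE; field; rewrite gt_eqF // addr_gt0 // exprn_gt0 //.
  rewrite e; apply: ler_wpM2l.
    by apply: divr_ge0; [apply: mulr_ge0 => //; exact: ltW|rewrite addr_ge0 // sqr_ge0].
  have e0 : 0 <= 1 + s * s ^+ 2 by rewrite addr_ge0 // mulr_ge0 // ltW.
  by rewrite ler_pXn2r ?nnegrE ?lerD2l ?(ltW d0).
have x2 : s ^+ 2 <= x ^+ 2 by rewrite lerXn2r ?nnegrE ?(ltW s0) ?(ltW x0).
have [hx|hx] := lerP (lam * s) x.
  have : lam * s ^+ 2 <= x ^+ 2.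
    apply: le_trans (_ : _ <= (lam * s) ^+ 2) _; last by rewrite lerXn2r ?nnegrE ?mulr_ge0 ?(ltW s0) ?(ltW x0) ?(ltW lam0).
    rewrite exprMn ler_wpM2r ?(ltW s20) // expr2 ler_peMl ?(ltW lam0) // ltW //.
  move=> hx2; rewrite (_ : lam * _ = (lam * s ^+ 2) * s ^+ 2); last by ring.
  by apply: ler_pM => //; try apply: mulr_ge0; exact: ltW.
have hy : lam * s ^+ 2 <= y by lra.
rewrite (_ : lam * _ = s ^+ 2 * (lam * s ^+ 2)); last by ring.
by apply: ler_pM => //; try apply: mulr_ge0; exact: ltW.
Qed.

(** The points c and -c are at pseudo-hyperbolic distance 2A / (1 + A^2). The double value at [x]
    bounds this by |blas x y|^2, hence by the expression in [real_aVb0]. *)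
Lemma bound_aVb0 (A : R) : 0 < A < 1 -> exists2 m, A ^+ 2 < m &
  forall f c x y, cabs c = A -> self_map f -> cabs x < 1 -> cabs y < 1 -> f 0 = 0 ->
  f x = c -> cderiv f x 0 -> f y = - c -> m <= cabs x ^+ 2 * cabs y.
Proof.
move=> /andP[A0 A1]; pose s := Num.sqrt A.
have s0 : 0 < s by rewrite sqrtr_gt0.
have AE : A = s ^+ 2 by rewrite sqr_sqrtr // ltW.
have s1 : s < 1 by rewrite -sqr_lt1 ?(ltW s0) // -AE.
pose l2 := 2 * (1 - s + s ^+ 2) ^+ 2 / (1 + s ^+ 4).
have d0 : 0 < 1 + s ^+ 4 by rewrite addr_gt0 // exprn_gt0.
have l21 : 1 < l2.
  rewrite /l2 ltr_pdivlMr // mul1r -subr_gt0.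
  have -> : 2 * (1 - s + s ^+ 2) ^+ 2 - (1 + s ^+ 4) = (1 - s) ^+ 4 by ring.
  by rewrite exprn_gt0 // subr_gt0.
pose lam := Num.sqrt l2.
have lamE : lam ^+ 2 = l2 by rewrite sqr_sqrtr // (le_trans ler01) // ltW.
have lam1 : 1 < lam by rewrite -sqrtr1 ltr_sqrt // (lt_trans ltr01).
exists (lam * A ^+ 2).
  by rewrite ltr_pMl // exprn_gt0.
move=> f c x y cA sf hx hy f0 fx Hx fy.
have [k [hk kD fk k0]] := double_point sf hx f0 fx Hx.
have z1 : cabs (0 : C) < 1 by rewrite cabs0.
have ax : A <= cabs x ^+ 2 by rewrite -cA k0 ler_piMr ?kD ?exprn_ge0 ?cabs_ge0.
have ay : A <= cabs y by have := schwarz sf.1 sf.2 f0 hy; rewrite fy cabsN cA.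
apply: (real_aVb0 s0 s1 AE lamE lam1) => //.
  by rewrite -(@ler_pXn2r _ 2) ?nnegrE ?cabs_ge0 ?(ltW s0) // -AE.
have := fk y hy; rewrite fy => E; rewrite -cA -cabs_blas_opp E cabsM cabsX.
apply: le_trans (_ : _ <= cabs (blas x y) ^+ 2) _; first by rewrite ler_piMr ?exprn_ge0 ?cabs_ge0 ?kD.
rewrite lerXn2r ?nnegrE ?divr_ge0 ?addr_ge0 ?mulr_ge0 ?cabs_ge0 //.
by apply: cabs_blas_le => //; exact: ltW.
Qed.

(** (x + y) / (1 + x y) is the addition law of the hyperbolic tangent; it bounds pseudo-hyperbolic
    distances in [cabs_blas_le]. *)
Let hyp_add_mono (x y s t : R) : 0 <= x -> 0 <= y -> x <= s -> y <= t -> s < 1 -> t < 1 ->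
  (x + y) / (1 + x * y) <= (s + t) / (1 + s * t).
Proof.
move=> x0 y0 xs yt s1 t1.
have s0 := le_trans x0 xs; have t0 := le_trans y0 yt.
rewrite ler_pdivrMr ?ltr_wpDr ?mulr_ge0 // mulrAC ler_pdivlMr ?ltr_wpDr ?mulr_ge0 //.
rewrite -subr_ge0.
have -> : (s + t) * (1 + x * y) - (x + y) * (1 + s * t) =
  (s - x) * (1 - t * y) + (t - y) * (1 - s * x) by ring.
have ty : t * y <= 1 by apply: mulr_ile1 => //; apply: ltW => //; exact: le_lt_trans t1.
have sx : s * x <= 1 by apply: mulr_ile1 => //; apply: ltW => //; exact: le_lt_trans s1.
by apply: addr_ge0; apply: mulr_ge0; rewrite subr_ge0.
Qed.

Let hyp_add_lt1 (s t : R) : 0 <= s -> s < 1 -> 0 <= t -> t < 1 ->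
  (s + t) / (1 + s * t) < 1.
Proof.
move=> s0 s1 t0 t1; rewrite ltr_pdivrMr ?ltr_wpDr ?mulr_ge0 // mul1r -subr_gt0.
have -> : 1 + s * t - (s + t) = (1 - s) * (1 - t) by ring.
by rewrite mulr_gt0 // subr_gt0.
Qed.

Let hyp_add_ge (s t : R) : 0 <= s -> 0 <= t -> t <= 1 -> t <= (s + t) / (1 + s * t).
Proof.
move=> s0 t0 t1; rewrite ler_pdivlMr ?ltr_wpDr ?mulr_ge0 // -subr_ge0.
have -> : s + t - t * (1 + s * t) = s * (1 - t ^+ 2) by ring.
by rewrite mulr_ge0 // subr_ge0 expr_le1.
Qed.

Let antipode (v : C) : cabs v < 1 -> cabs (blas v (- v)) * (1 + cabs v ^+ 2) = 2 * cabs v.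
Proof.
move=> hv; by rewrite cabs_blas_opp divfK // gt_eqF // ltr_wpDr // exprn_ge0 // cabs_ge0.
Qed.

(* With v = blas x y and z = blas x (- v), the points y and z are conjugate under the symmetry about x,
   so f z is close to f y when k1 is almost constant, whereas k2 keeps f z away from f y. *)
Let two_double_points f c x y k1 k2 (rho q : R) : self_map f -> 0 < cabs c ->
  cabs c < 1 -> cabs x < 1 -> cabs y < 1 -> f y = - c ->
  hol k1 -> (forall z, cabs z < 1 -> cabs (k1 z) <= 1) ->
  (forall z, cabs z < 1 -> blas c (f z) = blas x z ^+ 2 * k1 z) ->
  hol k2 -> (forall z, cabs z < 1 -> cabs (k2 z) <= 1) ->
  (forall z, cabs z < 1 -> blas (- c) (f z) = blas y z ^+ 2 * k2 z) ->
  rho < 1 -> cabs y <= rho -> cabs (blas x y) <= rho -> cabs (blas x (- blas x y)) <= rho ->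
  1 - cabs (k1 0) ^+ 2 <= q -> 1 - cabs (k2 0) ^+ 2 <= q ->
  (1 - rho) ^+ 2 / 4 <= q.
Proof.
move=> [hf fD] c0 c1 hx hy fy hk1 k1D fk1 hk2 k2D fk2 rho1 hyr; set v := blas x y => hvr hzr q1 q2.
rewrite leNgt; apply/negP => hq.
set z := blas x (- v) in hzr.
have hv : cabs v < 1 by apply: cabs_blas_lt1.
have hNv : cabs (- v) < 1 by rewrite cabsN.
have hz : cabs z < 1 by apply: cabs_blas_lt1.
have xz : blas x z = - v by apply: blasK.
set V := cabs v in hv hvr.
have V0 : 0 <= V by exact: cabs_ge0.
have gy := fk1 y hy; have gz := fk1 z hz; rewrite -/v in gy; rewrite xz sqrrN in gz.
have Vpos : 0 < V.
  rewrite cabs_gt0; apply: contraTneq c0 => v0.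
  have : cabs (blas c (f y)) = 0 by rewrite gy v0 expr0n mul0r cabs0.
  rewrite fy cabs_blas_opp => /eqP; rewrite mulf_eq0 invr_eq0 mulf_eq0 pnatr_eq0 /=.
  rewrite [1 + _ == 0]gt_eqF ?ltr_wpDr ?exprn_ge0 ?cabs_ge0 // orbF => /eqP ->.
  by rewrite ltxx.
have V2 : V ^+ 2 < 1 by rewrite sqr_lt1.
have V41 : V ^+ 2 * V ^+ 2 < 1.
  by apply: (le_lt_trans _ V2); rewrite ler_piMl ?exprn_ge0 // ltW.
(* The distance of f y and f z computed from the double value at [y]: by [blas_isometry], y and z
   are as far apart as v and -v. *)
have lhs : cabs (blas (f y) (f z)) * (1 + V ^+ 2) ^+ 2 = 4 * V ^+ 2 * cabs (k2 z).
  rewrite fy fk2 // cabsM cabsX -(blas_isometry hx hy hz) -/v xz.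
  have := antipode hv; rewrite -/V => a; rewrite mulrAC -exprMn a; ring.
(* The same distance seen from the double value at [x]: after the transformation [blas c] the two
   points are v^2 k1 y and v^2 k1 z. *)
have rhs : cabs (blas (f y) (f z)) * (1 - V ^+ 2 * V ^+ 2) <= V ^+ 2 * cabs (k1 y - k1 z).
  have fy1 := fD y hy; have fz1 := fD z hz.
  rewrite -(blas_isometry c1 fy1 fz1) gy gz.
  have l1 : cabs (v ^+ 2 * k1 y) <= V ^+ 2.
    by rewrite cabsM cabsX -/V ler_piMr ?exprn_ge0 // k1D.
  have l2 : cabs (v ^+ 2 * k1 z) <= V ^+ 2.
    by rewrite cabsM cabsX -/V ler_piMr ?exprn_ge0 // k1D.
  have d0 := blas_den_gt0 (le_lt_trans l1 V2) (le_trans l2 (ltW V2)).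
  rewrite /blas -mulrBr cabsM cabsV [cabs (_ * _)]cabsM cabsX -/V.
  rewrite mulrAC ler_pdivrMr // ler_wpM2l ?mulr_ge0 ?exprn_ge0 ?cabs_ge0 //.
  apply: le_trans (blas_den_ge _ _); rewrite lerD2l lerN2.
  by apply: ler_pM => //; exact: cabs_ge0.
have key : 4 * cabs (k2 z) * (1 - V ^+ 2) <= (1 + V ^+ 2) * cabs (k1 y - k1 z).
  have V2p : 0 < V ^+ 2 by rewrite exprn_gt0.
  have dp : 0 < 1 + V ^+ 2 by rewrite ltr_wpDr // ltW.
  rewrite -(@ler_pM2l _ (V ^+ 2 * (1 + V ^+ 2))) ?mulr_gt0 //.
  have -> : V ^+ 2 * (1 + V ^+ 2) * (4 * cabs (k2 z) * (1 - V ^+ 2)) =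
    (4 * V ^+ 2 * cabs (k2 z)) * (1 - V ^+ 2 * V ^+ 2) by ring.
  rewrite -lhs mulrAC.
  have -> : V ^+ 2 * (1 + V ^+ 2) * ((1 + V ^+ 2) * cabs (k1 y - k1 z)) =
    V ^+ 2 * cabs (k1 y - k1 z) * (1 + V ^+ 2) ^+ 2 by ring.
  by rewrite ler_wpM2r // exprn_ge0 // ltW.
pose w := 1 - rho.
have w0 : 0 < w by rewrite subr_gt0.
have w1 : w <= 1 by rewrite /w lerBlDr lerDl (le_trans (cabs_ge0 y)).
have q0 : 0 <= 1 - cabs (k2 0) ^+ 2 by rewrite subr_ge0 expr_le1 ?cabs_ge0 ?k2D ?cabs0.
(* The assumption q < w^2 / 4 makes [k1] and [k2] vary by at most w / 4 on the disc of radius [rho].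
   Then [key] gives 2 w <= w. *)
have ac k u : hol k -> (forall z, cabs z < 1 -> cabs (k z) <= 1) -> 1 - cabs (k 0) ^+ 2 <= q ->
    cabs u <= rho -> cabs (k u - k 0) <= w / 4.
  move=> hk kD kq hu; have hu1 := le_lt_trans hu rho1.
  have kq0 : 0 <= 1 - cabs (k 0) ^+ 2 by rewrite subr_ge0 expr_le1 ?cabs_ge0 ?kD ?cabs0.
  have h := almost_constant hk kD hu1.
  have h2 : cabs (k u - k 0) * w <= cabs (k u - k 0) * (1 - cabs u).
    by rewrite ler_wpM2l ?cabs_ge0 // lerD2l lerN2.
  have h3 : cabs u * (1 - cabs (k 0) ^+ 2) <= 1 - cabs (k 0) ^+ 2 by rewrite ler_piMl // ltW.
  rewrite -(ler_pM2r w0); apply: le_trans h2 (le_trans h (le_trans h3 (le_trans kq _))).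
  by apply: ltW; apply: lt_le_trans hq _; rewrite le_eqVlt /w; apply/orP; left; apply/eqP; field.
have b1 := ac k1 y hk1 k1D q1 hyr; have b2 := ac k1 z hk1 k1D q1 hzr; have b3 := ac k2 z hk2 k2D q2 hzr.
have c12 : cabs (k1 y - k1 z) <= w / 2.
  rewrite (_ : k1 y - k1 z = (k1 y - k1 0) - (k1 z - k1 0)); last by ring.
  by apply: le_trans (ler_cabsB _ _) _; lra.
have k20 : 1 - w / 4 <= cabs (k2 0).
  have : 1 - q <= cabs (k2 0) ^+ 2 by lra.
  have : cabs (k2 0) ^+ 2 <= cabs (k2 0).
    by rewrite expr2 ler_piMl ?cabs_ge0 ?k2D ?cabs0.
  have : q < w / 4.
    apply: lt_le_trans hq _; rewrite -/w expr2 ler_pM2r ?invr_gt0 //.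
    by rewrite ler_piMl // ltW.
  lra.
have k2z : 1 / 2 <= cabs (k2 z).
  have := ler_cabs_sub (k2 0) (k2 z); rewrite cabs_sub; lra.
have Vw : w <= 1 - V ^+ 2.
  have : V ^+ 2 <= V by rewrite expr2 ler_piMl // ltW.
  rewrite /w; lra.
have l1 : 2 * w <= 4 * cabs (k2 z) * (1 - V ^+ 2).
  by apply: ler_pM => //; [exact: ltW|lra].
have l2 : (1 + V ^+ 2) * cabs (k1 y - k1 z) <= 2 * (w / 2).
  by apply: ler_pM => //; [rewrite addr_ge0 // exprn_ge0|exact: cabs_ge0|lra].
lra.
Qed.

(** If |x|^2 or |y|^2 is at least the square root s of A, the product is at least s A > A^2.
    Otherwise both points lie in the disc of radius A^(1/4), [V0] and [rho] bound the points of
    [two_double_points], and one of |k1 0|, |k2 0| is bounded away from 1. *)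
Lemma bound_aVbV (A : R) : 0 < A < 1 -> exists2 m, A ^+ 2 < m &
  forall f c x y, cabs c = A -> self_map f -> cabs x < 1 -> cabs y < 1 -> f 0 = 0 ->
  f x = c -> cderiv f x 0 -> f y = - c -> cderiv f y 0 -> m <= cabs x ^+ 2 * cabs y ^+ 2.
Proof.
move=> /andP[A0 A1]; pose s := Num.sqrt A; pose sg := Num.sqrt s.
have s0 : 0 < s by rewrite sqrtr_gt0.
have AE : A = s ^+ 2 by rewrite sqr_sqrtr // ltW.
have s1 : s < 1 by rewrite -sqr_lt1 ?(ltW s0) // -AE.
have sg0 : 0 < sg by rewrite sqrtr_gt0.
have sE : s = sg ^+ 2 by rewrite sqr_sqrtr // ltW.
have sg1 : sg < 1 by rewrite -sqr_lt1 ?(ltW sg0) // -sE.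
pose V0 := (sg + sg) / (1 + sg * sg).
have V00 : 0 <= V0 by rewrite divr_ge0 ?addr_ge0 ?mulr_ge0 // ltW.
have V01 : V0 < 1 by apply: hyp_add_lt1 => //; exact: ltW.
pose rho := (sg + V0) / (1 + sg * V0).
have rho1 : rho < 1 by apply: hyp_add_lt1 => //; exact: ltW.
have V0rho : V0 <= rho by apply: hyp_add_ge => //; exact: ltW.
have sgV0 : sg <= V0 by apply: hyp_add_ge; exact: ltW.
pose del := (1 - rho) ^+ 2 / 4.
have rho0 : 0 <= rho by apply: le_trans V0rho.
have del0 : 0 < del by rewrite divr_gt0 // exprn_gt0 // subr_gt0.
have del1 : del < 1.
  have : (1 - rho) ^+ 2 <= 1 by rewrite expr_le1 ?subr_ge0 ?(ltW rho1) // lerBlDr lerDl.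
  rewrite /del; lra.
exists (Num.min (s * A) (A * A / (1 - del / 2))).
  have d0 : 0 < 1 - del / 2 by lra.
  rewrite lt_min; apply/andP; split.
    rewrite expr2 ltr_pM2r // AE expr2 -[ltRHS]mul1r ltr_pM2r //.
  by rewrite ltr_pdivlMr // expr2 -[ltRHS]mulr1 ltr_pM2l ?mulr_gt0 //; lra.
move=> f c x y cA sf hx hy f0 fx Hx fy Hy.
have [k1 [hk1 k1D fk1 k10]] := double_point sf hx f0 fx Hx.
have [k2 [hk2 k2D fk2 k20]] := double_point sf hy f0 fy Hy.
have z1 : cabs (0 : C) < 1 by rewrite cabs0.
have ax : A <= cabs x ^+ 2 by rewrite -cA k10 ler_piMr ?k1D ?exprn_ge0 ?cabs_ge0.
have ay : A <= cabs y ^+ 2 by rewrite -cA -cabsN k20 ler_piMr ?k2D ?exprn_ge0 ?cabs_ge0.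
rewrite cabsN in k20; rewrite cA in k10 k20.
rewrite ge_min; have [hxs|hxs] := lerP s (cabs x ^+ 2).
  by apply/orP; left; apply: ler_pM => //; exact: ltW.
have [hys|hys] := lerP s (cabs y ^+ 2).
  by apply/orP; left; rewrite mulrC; apply: ler_pM => //; exact: ltW.
apply/orP; right.
have xsg : cabs x <= sg.
  by rewrite -(@ler_pXn2r _ 2) ?nnegrE ?cabs_ge0 ?(ltW sg0) // -sE ltW.
have ysg : cabs y <= sg.
  by rewrite -(@ler_pXn2r _ 2) ?nnegrE ?cabs_ge0 ?(ltW sg0) // -sE ltW.
have vV0 : cabs (blas x y) <= V0.
  apply: le_trans (cabs_blas_le hx (ltW hy)) _.
  by apply: hyp_add_mono => //; exact: cabs_ge0.
have zrho : cabs (blas x (- blas x y)) <= rho.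
  have h1 : cabs (- blas x y) <= 1 by rewrite cabsN; apply: le_trans vV0 (ltW V01).
  apply: le_trans (cabs_blas_le hx h1) _; rewrite cabsN.
  by apply: hyp_add_mono => //; exact: cabs_ge0.
have c0 : 0 < cabs c by rewrite cA.
have c1 : cabs c < 1 by rewrite cA.
have d0 : 0 < 1 - del / 2 by lra.
have yrho : cabs y <= rho by apply: le_trans ysg (le_trans sgV0 V0rho).
have T (q : R) := @two_double_points f c x y k1 k2 rho q sf c0 c1 hx hy fy hk1 k1D fk1 hk2 k2D fk2 rho1 yrho
  (le_trans vV0 V0rho) zrho.
(* From |k 0|^2 <= 1 - del <= (1 - del / 2)^2 follows |k 0| <= 1 - del / 2. *)
have fin (k : C -> C) (X : R) : cabs (k 0) <= 1 -> A = X * cabs (k 0) -> 0 <= X -> del <= 1 - cabs (k 0) ^+ 2 ->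
    A / (1 - del / 2) <= X.
  move=> kD kE X0 dk; rewrite ler_pdivrMr // kE ler_wpM2l //.
  rewrite -(@ler_pXn2r _ 2) ?nnegrE ?cabs_ge0 ?(ltW d0) //.
  have : 0 <= del ^+ 2 by exact: sqr_ge0.
  rewrite (_ : (1 - del / 2) ^+ 2 = 1 - del + del ^+ 2 / 4); last by field.
  lra.
have := lexx (1 - cabs (k1 0) ^+ 2); have := lexx (1 - cabs (k2 0) ^+ 2).
(* The larger of the two defects serves as [q], and the improved bound goes to the corresponding
   point. *)
have [h12|h12] := lerP (1 - cabs (k1 0) ^+ 2) (1 - cabs (k2 0) ^+ 2) => e2 e1.
  have := T _ h12 e2; rewrite -/del => hd.
  rewrite -mulrA; apply: ler_pM => //; rewrite ?divr_ge0 ?(ltW A0) ?(ltW d0) //.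
  by apply: (fin k2) => //; rewrite ?exprn_ge0 ?cabs_ge0 ?k2D.
have := T _ e1 (ltW h12); rewrite -/del => hd.
rewrite mulrAC; apply: ler_pM => //; rewrite ?divr_ge0 ?(ltW A0) ?(ltW d0) //.
by apply: (fin k1) => //; rewrite ?exprn_ge0 ?cabs_ge0 ?k1D.
Qed.

End LowerBounds.

(** * Upper bound *)

Section UpperBound.
Variable R : realType.
Local Notation C := (R[i])%C.
Implicit Types (f : C -> C).

Lemma elog_neq0 (z : C) : z != 0 -> elog z = (ln (cabs z))%:E.
Proof. by move=> z0; rewrite /elog (negbTE z0). Qed.

Lemma hol_holD f : hol f -> holD f.
Proof. by move=> hf z hz; apply/derivableC; exact: hf. Qed.

Lemma holD_hol f : holD f -> hol f.
Proof. by move=> hf z hz; apply/derivableC; exact: hf. Qed.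

(** The two preimages of s^2 under squaring are treated together; this yields the product of the
    moduli of the points over t^2 and over w^2. *)
Lemma blas_pm (x s : C) : conjc x = x -> cabs x < 1 -> cabs s < 1 ->
  blas x s * blas x (- s) = blas (x ^+ 2) (s ^+ 2).
Proof.
move=> cx hx hs; have n1 := blas_den_neq0 hx (ltW hs).
have n2 := @blas_den_neq0 _ x (- s) hx; rewrite cabsN in n2; move: (n2 (ltW hs)) n1 => {}n2 n1.
rewrite /blas rmorphXn /= cx; rewrite cx in n1 n2.
have n3 : 1 - (x * s) ^+ 2 != 0.
  by rewrite (_ : _ - _ = (1 - x * s) * (1 - x * - s)) ?mulf_neq0 //; ring.
by field; rewrite n1 n2 n3.
Qed.

(* The maps are written in the coordinate Z = blas x z, in which the base point 0 becomes x and the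
   points of the disc mapped to the poles become t, w, - w, - t. *)
Lemma four_pole_map (x w a g eps t r e c d : C) :
  conjc x = x -> conjc w = w -> cabs x < 1 -> cabs w < 1 -> cabs t < 1 -> x != 0 -> w != 0 ->
  w ^+ 2 * (1 + (x ^+ 2) ^+ 2) = 2 * x ^+ 2 ->
  cabs r + cabs e < 1 -> cabs (eps / 2) + cabs (eps / (2 * w)) + cabs c + 2 * cabs d < 1 ->
  blas (x ^+ 2) (t ^+ 2) != 0 ->
  blas (x ^+ 2) (t ^+ 2) * (r + e * t ^+ 2) = a ->
  x ^+ 2 * (r + e * w ^+ 2) = a ->
  eps / 2 - eps / (2 * w) * x - x * x ^+ 2 * c = g ->
  eps / 2 - eps / (2 * w) * t - t * blas (w ^+ 2) (t ^+ 2) * (c + d * (t ^+ 2 - x ^+ 2)) = 0 ->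
  (Leps_aVbV a (- a)%R eps (0%R, g) <= (ln (cabs (blas (x ^+ 2) (t ^+ 2)) * cabs x ^+ 2)%R)%:E)%E.
Proof.
move=> cx cw hx hw ht x0 w0 wE bre bcd tn0 e1 e2 e3 e4.
set P := x ^+ 2 in wE tn0 e1 e2 e3 e4 *; set W := w ^+ 2 in wE e2 e4 *.
have sq1 (z : C) : cabs z < 1 -> cabs (z ^+ 2) < 1 by move=> hz; rewrite cabsX sqr_lt1 ?cabs_ge0.
have hP : cabs P < 1 by exact: sq1.
have hW : cabs W < 1 by exact: sq1.
have P0 : P != 0 by rewrite expf_neq0.
have cP : conjc P = P by rewrite rmorphXn /= cx.
have cW : conjc W = W by rewrite rmorphXn /= cw.
have nPW := blas_den_neq0 hP (ltW hW); rewrite cP in nPW.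
(* The equation for [w] says that [blas P] takes the value -P at W, while it takes the value P at 0;
   so r = a / P and e = 0 give a at 0 and -a at w, -w. *)
have PW : P - W = - P * (1 - P * W).
  have -> : - P * (1 - P * W) = (W * (1 + P ^+ 2) - 2 * P) + (P - W) by ring.
  by rewrite wE subrr add0r.
have bPW : blas P W = - P by rewrite /blas cP PW mulfK.
have bWP : blas W P = P.
  rewrite /blas cW [W * P]mulrC (_ : W - P = P * (1 - P * W)) ?mulfK //.
  by rewrite -(opprB P W) PW mulNr opprK.
(* [G1] is even, and [G2] is eps / 2 plus an odd function, so zeros of [G2] at t and w become values
   eps at -t and -w. The term with [d] vanishes at the base point, where Z^2 = P, and leaves the
   value [g] there unchanged. *)
pose G1 Z : C := blas P (Z * Z) * (r + e * (Z * Z)).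
pose G2 Z : C := (eps / 2 + (- (eps / (2 * w))) * Z) + (- Z) * (blas W (Z * Z) * (c + d * (Z * Z + - P))).
have hsq : hol (fun Z : C => Z * Z) by apply: hol_mul; exact: hol_id.
have sqD (z : C) : cabs z < 1 -> cabs (z * z) < 1 by rewrite -expr2; exact: sq1.
have hG1 : hol G1.
  apply: hol_mul; first exact: hol_comp hsq sqD (hol_blas hP).
  by apply: hol_add; [exact: hol_cst|apply: hol_mul; [exact: hol_cst|exact: hsq]].
have hG2 : hol G2.
  apply: hol_add.
    by apply: hol_add; [exact: hol_cst|apply: hol_mul; [exact: hol_cst|exact: hol_id]].
  have -> : (fun Z : C => - Z * (blas W (Z * Z) * (c + d * (Z * Z + - P)))) =
     (fun Z => (-1 * Z) * (blas W (Z * Z) * (c + d * (Z * Z + - P)))).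
    by apply/funext => Z; rewrite mulN1r.
  apply: hol_mul; first by apply: hol_mul; [exact: hol_cst|exact: hol_id].
  apply: hol_mul; first exact: hol_comp hsq sqD (hol_blas hW).
  apply: hol_add; first exact: hol_cst.
  apply: hol_mul; first exact: hol_cst.
  by apply: hol_add; [exact: hsq|exact: hol_cst].
have G1D Z : cabs Z < 1 -> cabs (G1 Z) < 1.
  move=> hZ; rewrite cabsM; apply: le_lt_trans bre.
  apply: le_trans (_ : _ <= 1 * cabs (r + e * (Z * Z))) _.
    by rewrite ler_wpM2r ?cabs_ge0 // ltW // cabs_blas_lt1 // sqD.
  rewrite mul1r; apply: le_trans (ler_cabsD _ _) _; rewrite lerD2l cabsM ler_piMr ?cabs_ge0 //.
  by rewrite ltW // sqD.
have G2D Z : cabs Z < 1 -> cabs (G2 Z) < 1.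
  move=> hZ; apply: le_lt_trans bcd; rewrite -[leRHS]addrA.
  apply: le_trans (ler_cabsD _ _) _; apply: lerD.
    apply: le_trans (ler_cabsD _ _) _; rewrite lerD2l mulNr cabsN [leLHS]cabsM.
    by rewrite ler_piMr ?cabs_ge0 // ltW.
  have hZ2 := sqD _ hZ.
  have b1 : cabs (Z * Z + - P) <= 2.
    by apply: le_trans (ler_cabsB _ _) _; have := ltW hZ2; have := ltW hP; lra.
  have b2 : cabs (c + d * (Z * Z + - P)) <= cabs c + 2 * cabs d.
    by apply: le_trans (ler_cabsD _ _) _; rewrite lerD2l cabsM mulrC ler_wpM2r ?cabs_ge0.
  apply: le_trans b2; rewrite cabsM cabsN cabsM mulrA ler_piMl ?cabs_ge0 //.
  by rewrite mulr_ile1 ?cabs_ge0 ?(ltW hZ) // ltW // cabs_blas_lt1.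
pose phi1 z := G1 (blas x z); pose phi2 z := G2 (blas x z).
have bD z : cabs z < 1 -> cabs (blas x z) < 1 by move=> hz; exact: cabs_blas_lt1.
have hpm (s : C) : cabs s < 1 -> cabs (- s) < 1 by rewrite cabsN.
have ev1 s : cabs s < 1 -> phi1 (blas x s) = G1 s by move=> hs; rewrite /phi1 blasK.
have ev2 s : cabs s < 1 -> phi2 (blas x s) = G2 s by move=> hs; rewrite /phi2 blasK.
have G1N s : G1 (- s) = G1 s by rewrite /G1 mulrNN.
have G2N s : G2 (- s) = eps - G2 s.
  by rewrite /G2 mulrNN; move: (blas W _) => b; field; rewrite w0 ?pnatr_eq0.
have G1t : G1 t = a by rewrite /G1 -expr2.
have G1w : G1 w = - a by rewrite /G1 -expr2 -/W bPW mulNr e2.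
have G2t : G2 t = 0.
  by rewrite /G2 -[t * t]expr2 -[RHS]e4; ring.
have G2w : G2 w = 0.
  by rewrite /G2 -expr2 -/W blasxx mul0r mulr0 addr0; field; rewrite w0 ?pnatr_eq0.
have prodt := blas_pm cx hx ht; have prodw := blas_pm cx hx hw.
rewrite -/P in prodt prodw; rewrite -/W bPW in prodw.
have : blas x t * blas x (- t) != 0 by rewrite prodt.
rewrite mulf_eq0 negb_or => /andP[nt1 nt2].
have : blas x w * blas x (- w) != 0 by rewrite prodw oppr_eq0.
rewrite mulf_eq0 negb_or => /andP[nw1 nw2].
apply: ereal_inf_lbound.
exists phi1, phi2, [:: blas x t; blas x w; blas x (- w); blas x (- t)].
split => //; split; [split; [|split]|split; [|split; [|split]]].
- by apply: hol_holD; apply: (hol_comp (hol_blas hx) bD hG1).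
- by apply: hol_holD; apply: (hol_comp (hol_blas hx) bD hG2).
- by move=> z hz; split; [apply: G1D|apply: G2D]; exact: bD.
- by move=> z; rewrite !inE => /or4P[] /eqP ->; apply: bD => //; exact: hpm.
- rewrite /phi1 /phi2 !blas0; congr (_, _); first by rewrite /G1 -expr2 -/P blasxx mul0r.
  by rewrite /G2 -expr2 -/P bWP subrr mulr0 addr0 -[RHS]e3; ring.
- case=> [|[|[|[|//]]]] _ /=.
  + by rewrite ev1 // ev2 // G1t G2t.
  + by rewrite ev1 // ev2 // G1w G2w.
  + by rewrite ev1 ?ev2 ?hpm // G1N G2N G1w G2w subr0.
  + by rewrite ev1 ?ev2 ?hpm // G1N G2N G1t G2t subr0.
(* By [blas_pm] the four points have product -P times [blas P (t ^+ 2)]. *)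
- rewrite !big_cons big_nil !elog_neq0 // adde0 -!EFinD; congr (_%:E).
  rewrite -cabsX -/P -[cabs P]cabsN -prodt -prodw.
  rewrite (cabsM (blas x t)) (cabsM (blas x w)).
  move: nt1 nt2 nw1 nw2; rewrite -!cabs_gt0.
  move: (cabs (blas x t)) (cabs (blas x (- t))) (cabs (blas x w)) (cabs (blas x (- w))) => p1 p2 p3 p4 h1 h2 h3 h4.
  by rewrite !lnM ?posrE ?mulr_gt0 //; ring.
Qed.

Lemma ccontV f z : ccont f z -> f z != 0 -> ccont (fun u => (f u)^-1) z.
Proof.
move=> cf fz; apply: (ccont_comp cf).
exact: cderiv_cont (@cderivV _ id _ _ fz (cderiv_id _)).
Qed.

Definition near0 (Q : C -> Prop) := exists2 d : R, 0 < d & forall h, cabs h < d -> Q h.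

Lemma near0_and (Q1 Q2 : C -> Prop) : near0 Q1 -> near0 Q2 -> near0 (fun h => Q1 h /\ Q2 h).
Proof.
move=> [d1 d10 h1] [d2 d20 h2]; exists (Num.min d1 d2); first by rewrite lt_min d10.
by move=> h; rewrite lt_min => /andP[/h1 ? /h2 ?].
Qed.

Lemma near0_lt f (k : R) : ccont f 0 -> cabs (f 0) < k -> near0 (fun h => cabs (f h) < k).
Proof.
move=> cf fk; have [|d d0 hd] := cf ((k - cabs (f 0)) / 2); first by rewrite divr_gt0 // subr_gt0.
exists d => // h /hd; rewrite add0r => l.
have := ler_cabs_sub (f h) (f 0); lra.
Qed.

Lemma near0_neq0 f : ccont f 0 -> f 0 != 0 -> near0 (fun h => f h != 0).
Proof.
move=> cf f0; have [|d d0 hd] := cf (cabs (f 0) / 2); first by rewrite divr_gt0 // cabs_gt0.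
exists d => // h /hd; rewrite add0r -cabs_gt0 => l.
have := ler_cabs_sub (f 0) (f h); rewrite cabs_sub -cabs_gt0 in f0 *; lra.
Qed.

End UpperBound.

(** * Choice of the parameters and passage to the limit *)

Section Limit.
Variable R : realType.
Local Notation C := (R[i])%C.

(** All parameters of [four_pole_map] are chosen continuous in eps, and the strict inequalities it
    requires hold at eps = 0; they persist for small eps. *)
Lemma Leps_near0 (a g : C) (P m : R) : 0 < P -> P < 1 -> cabs a < P -> g != 0 ->
  cabs g ^+ 2 < P ^+ 3 -> P ^+ 2 < m ->
  near0 (fun eps : C => eps != 0 -> (Leps_aVbV a (- a)%R eps (0%R, g) <= (ln m)%:E)%E).
Proof.
move=> P0 P1 aP g0 gP Pm.
pose xr := Num.sqrt P; have xr0 : 0 < xr by rewrite sqrtr_gt0.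
have xrE : xr ^+ 2 = P by rewrite sqr_sqrtr // ltW.
pose Wr := 2 * P / (1 + P ^+ 2); have Wd : 0 < 1 + P ^+ 2 by rewrite addr_gt0 // exprn_gt0.
have Wr0 : 0 < Wr by rewrite divr_gt0 // mulr_gt0.
pose wr := Num.sqrt Wr; have wr0 : 0 < wr by rewrite sqrtr_gt0.
have wrE : wr ^+ 2 = Wr by rewrite sqr_sqrtr // ltW.
have Wr1 : Wr < 1.
  rewrite ltr_pdivrMr // mul1r -subr_gt0 (_ : _ - _ = (1 - P) ^+ 2); last by ring.
  by rewrite exprn_gt0 // subr_gt0.
pose x : C := xr%:C; pose w : C := wr%:C.
have cx : cabs x = xr by rewrite cabs_real gtr0_norm.
have cw : cabs w = wr by rewrite cabs_real gtr0_norm.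
have x2 : x ^+ 2 = P%:C by rewrite -xrE rmorphXn.
have w2 : w ^+ 2 = Wr%:C by rewrite -wrE rmorphXn.
have x0 : x != 0 by rewrite -cabs_gt0 cx.
have w0 : w != 0 by rewrite -cabs_gt0 cw.
have hx : cabs x < 1 by rewrite cx -sqr_lt1 ?(ltW xr0) // xrE.
have hw : cabs w < 1 by rewrite cw -sqr_lt1 ?(ltW wr0) // wrE.
have hx2 : cabs (x ^+ 2) < 1 by rewrite cabsX sqr_lt1 ?cabs_ge0.
have conjx : conjc x = x by exact: conjc_real.
have conjw : conjc w = w by exact: conjc_real.
have conjx2 : conjc (x ^+ 2) = x ^+ 2 by rewrite x2; exact: conjc_real.
have conjw2 : conjc (w ^+ 2) = w ^+ 2 by rewrite w2; exact: conjc_real.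
have wE : w ^+ 2 * (1 + (x ^+ 2) ^+ 2) = 2 * x ^+ 2.
  have -> : 1 + (x ^+ 2) ^+ 2 = (1 + P ^+ 2)%:C by rewrite x2 rmorphD rmorph1 rmorphXn.
  rewrite w2 x2 -rmorphM /Wr divfK ?gt_eqF // rmorphM rmorph_nat //.
(* The value of [c] at eps = 0; its modulus is |g| / P^(3/2), and here the hypothesis on [g] is
   used. *)
pose c0 : C := - g / (x * x ^+ 2).
have c00 : c0 != 0 by rewrite mulf_neq0 ?oppr_eq0 // invr_eq0 mulf_neq0 // expf_neq0.
have kap : cabs c0 < 1.
  rewrite -sqr_lt1 ?cabs_ge0 // /c0 cabsM cabsN cabsV expr_div_n cabsM cabsX cx.
  rewrite ltr_pdivrMr ?exprn_gt0 ?mulr_gt0 ?exprn_gt0 // mul1r.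
  have e6 : (xr * xr ^+ 2) ^+ 2 = (xr ^+ 2) ^+ 3 by ring.
  by rewrite e6 xrE.
(* To first order the condition that [G2] vanishes at t reads eps / 2 = t w^2 c0. *)
pose tau : C := (2 * w ^+ 2 * c0)^-1.
have two0 : (2 : C) != 0 by rewrite pnatr_eq0.
have tau0 : tau != 0.
  by rewrite invr_eq0; apply: mulf_neq0 => //; apply: mulf_neq0 => //; exact: expf_neq0.
pose t (eps : C) : C := tau * eps.
pose t2 (eps : C) : C := t eps * t eps.
pose B (eps : C) : C := blas (x ^+ 2) (t2 eps).
(* [e] and [r] solve the two linear equations r + e t^2 = a / B and r + e w^2 = a / x^2. *)
pose e (eps : C) : C := (a * (B eps)^-1 + - (a / x ^+ 2)) * (t2 eps + - w ^+ 2)^-1.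
pose r (eps : C) : C := a / x ^+ 2 + e eps * (- w ^+ 2).
pose c (eps : C) : C := (- g + eps * (2^-1 + - (x / (2 * w)))) * (x * x ^+ 2)^-1.
(* With eps = t / tau, the equation for a zero of [G2] at t is divisible by t (w - t). Solving the
   quotient for [d] gives a formula that remains regular at eps = 0, where [tau] makes it vanish. *)
pose d (eps : C) : C := ((1 + - w ^+ 2 * t2 eps) * (2 * w * tau * (w + t eps))^-1 + -1 * c eps) * (t2 eps + - x ^+ 2)^-1.
have ct : ccont t 0 by apply: ccontM; [exact: ccont_cst|exact: cderiv_cont (cderiv_id _)].
have ct2 : ccont t2 0 by exact: ccontM.
have t00 : t 0 = 0 by rewrite /t mulr0.
have t20 : t2 0 = 0 by rewrite /t2 t00 mulr0.
have cB : ccont B 0.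
  have [|L HL] := cderiv_blas hx2 (z := t2 0); first by rewrite t20 cabs0.
  exact: ccont_comp ct2 (cderiv_cont HL).
have B0 : B 0 = x ^+ 2 by rewrite /B t20 blas0.
have x20 : x ^+ 2 != 0 by rewrite expf_neq0.
have w20 : w ^+ 2 != 0 by rewrite expf_neq0.
have ctw : ccont (fun eps => t2 eps + - w ^+ 2) 0 by apply: ccontD => //; exact: ccont_cst.
have ctx : ccont (fun eps => t2 eps + - x ^+ 2) 0 by apply: ccontD => //; exact: ccont_cst.
have tw0 : t2 0 + - w ^+ 2 != 0 by rewrite t20 add0r oppr_eq0.
have tx0 : t2 0 + - x ^+ 2 != 0 by rewrite t20 add0r oppr_eq0.
have cwt : ccont (fun eps => w + t eps) 0 by apply: ccontD => //; exact: ccont_cst.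
have wt0 : w + t 0 != 0 by rewrite t00 addr0.
have ce : ccont e 0.
  apply: ccontM; last exact: ccontV.
  apply: ccontD; last exact: ccont_cst.
  by apply: ccontM; [exact: ccont_cst|apply: ccontV => //; rewrite B0].
have e0 : e 0 = 0 by rewrite /e B0 subrr mul0r.
have cr : ccont r 0.
  by apply: ccontD; [exact: ccont_cst|apply: ccontM => //; exact: ccont_cst].
have r0 : r 0 = a / x ^+ 2 by rewrite /r e0 mul0r addr0.
have cc : ccont c 0.
  apply: ccontM; last exact: ccont_cst.
  apply: ccontD; first exact: ccont_cst.
  by apply: ccontM; [exact: cderiv_cont (cderiv_id _)|exact: ccont_cst].
have c0E : c 0 = c0 by rewrite /c mul0r addr0.
have den0 : 2 * w * tau * (w + t 0) != 0.
  by apply: mulf_neq0 => //; apply: mulf_neq0 => //; exact: mulf_neq0.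
have cd : ccont d 0.
  apply: ccontM; last exact: ccontV.
  apply: ccontD; last by apply: ccontM => //; exact: ccont_cst.
  apply: ccontM; last by apply: ccontV => //; apply: ccontM => //; exact: ccont_cst.
  by apply: ccontD; [exact: ccont_cst|apply: ccontM => //; exact: ccont_cst].
have d0 : d 0 = 0.
  rewrite /d c0E t20 t00 mulr0 !addr0 mul1r (_ : (2 * w * tau * w)^-1 = c0) ?mulN1r ?subrr ?mul0r //.
  rewrite /tau; move: (c0) c00 => k k0; field; by rewrite w0 k0 ?pnatr_eq0.
have cid (k : C) : ccont (fun eps : C => eps * k) 0.
  by apply: ccontM; [exact: cderiv_cont (cderiv_id _)|exact: ccont_cst].
pose al := cabs (a / x ^+ 2).
have al1 : al < 1.
  by rewrite /al cabsM cabsV x2 cabs_real gtr0_norm // ltr_pdivrMr // mul1r.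
(* The bound on [c] is (1 + |c0|) / 2 = 1 - 4 del, and the other terms in the bound on [G2] add up
   to less than 4 del. *)
pose del := (1 - cabs c0) / 8.
have del0 : 0 < del by rewrite divr_gt0 // subr_gt0.
have N1 : near0 (fun eps => cabs (t eps) < 1) by apply: near0_lt => //; rewrite t00 cabs0.
have N2 : near0 (fun eps => B eps != 0) by apply: near0_neq0 => //; rewrite B0.
have N3 := near0_neq0 ctw tw0.
have N4 := near0_neq0 cwt wt0.
have N5 := near0_neq0 ctx tx0.
have N6 : near0 (fun eps => cabs (r eps) < (1 + al) / 2) by apply: near0_lt => //; rewrite r0 -/al; lra.
have N7 : near0 (fun eps => cabs (e eps) < (1 - al) / 2) by apply: near0_lt => //; rewrite e0 cabs0 divr_gt0 // subr_gt0.
have N8 : near0 (fun eps => cabs (c eps) < (1 + cabs c0) / 2) by apply: near0_lt => //; rewrite c0E; lra.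
have N9 : near0 (fun eps => cabs (d eps) < del) by apply: near0_lt => //; rewrite d0 cabs0.
have N10 : near0 (fun eps : C => cabs (eps * 2^-1) < del) by apply: near0_lt => //; rewrite mul0r cabs0.
have N11 : near0 (fun eps : C => cabs (eps * (2 * w)^-1) < del) by apply: near0_lt => //; rewrite mul0r cabs0.
have N12 : near0 (fun eps : C => cabs (B eps * x ^+ 2) < m).
  apply: near0_lt; first by apply: ccontM => //; exact: ccont_cst.
  by rewrite B0 x2 cabsM cabs_real gtr0_norm // -expr2.
have [D D0 HD] := near0_and (near0_and (near0_and (near0_and N1 N2) (near0_and N3 N4)) (near0_and (near0_and N5 N6) (near0_and N7 N8)))
   (near0_and (near0_and N9 N10) (near0_and N11 N12)).
exists D => // eps /HD [[[[h1 h2] [h3 h4]] [[h5 h6] [h7 h8]]] [[h9 h10] [h11 h12]]] eps0.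
have tE : t2 eps = t eps ^+ 2 by rewrite expr2.
have Bm : cabs (blas (x ^+ 2) (t eps ^+ 2)) * cabs x ^+ 2 <= m.
  by rewrite -cabsX -cabsM -tE ltW.
have Bpos : 0 < cabs (blas (x ^+ 2) (t eps ^+ 2)) * cabs x ^+ 2.
  by rewrite mulr_gt0 ?exprn_gt0 ?cabs_gt0 // -tE.
apply: le_trans (_ : _ <= (ln (cabs (blas (x ^+ 2) (t eps ^+ 2)) * cabs x ^+ 2)%R)%:E)%E _; last first.
  by rewrite lee_fin ler_ln // posrE // (lt_le_trans Bpos).
apply: (@four_pole_map _ x w a g eps (t eps) (r eps) (e eps) (c eps) (d eps)) => //.
- by apply: lt_le_trans (ltrD h6 h7) _; lra.
- move: h8 h9 h10 h11; rewrite /del; lra.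
- rewrite -tE -/(B eps) /r /e.
  move: (B eps) (t2 eps) h2 h3 => b s b0 s0; field.
  by rewrite x0 b0 s0.
- rewrite /r; move: (e eps) => k; field; by rewrite x0.
- rewrite /c; field; by rewrite ?x0 ?w0 ?pnatr_eq0.
- have nd : 1 - w ^+ 2 * t eps ^+ 2 != 0.
    have hw2 : cabs (w ^+ 2) < 1 by rewrite cabsX sqr_lt1 ?cabs_ge0.
    have ht2 : cabs (t eps ^+ 2) <= 1 by rewrite cabsX expr_le1 ?cabs_ge0 // ltW.
    by have := blas_den_neq0 hw2 ht2; rewrite conjw2.
  have key : c eps + d eps * (t eps ^+ 2 - x ^+ 2) = (1 - w ^+ 2 * t eps ^+ 2) / (2 * w * tau * (w + t eps)).
    rewrite /d tE in h5 *; move: (c eps) => k; rewrite divfK //; ring.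
  rewrite key /blas conjw2 (_ : eps = t eps / tau); last by rewrite /t mulrAC divff // mul1r.
  have -> : t (t eps / tau) = t eps by rewrite {1}/t mulrC divfK.
  move: (t eps) (tau) tau0 h4 nd => s u u0 h4 nd; field.
  by apply/and4P; split; [exact: h4|exact: u0|exact: w0|rewrite exprMn; exact: nd].
Qed.

Lemma holD_cderiv0 (f : C -> C) (z : C) : holD f -> inD z -> derive1 (f : C -> C^o) z = 0 -> cderiv f z 0.
Proof.
move=> hf hz d0; have [L HL] := holD_hol hf hz.
by rewrite -d0 (cderiv_derive1 HL).
Qed.

Lemma limsup0_le (f : C -> \bar R) (l : \bar R) :
  near0 (fun eps => eps != 0 -> (f eps <= l)%E) -> (limsup0 f <= l)%E.
Proof.
move=> [d d0 hd]; apply: (@le_trans _ _ (ereal_sup [set f e | e in [set e : C | e != 0 /\ cabs e < d]])).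
  by apply: ereal_inf_lbound; exists d.
by apply: ge_ereal_sup => _ [eps /= [e0 ed] <-]; exact: hd.
Qed.

End Limit.
Local Close Scope complex_scope.

(** * Comparison of the upper bound with the four lower bounds *)

Theorem mainTheorem18 (R : realType) (a gamma : R[i]%C) :
  cabs a < 1 ->
  cabs a ^+ 2 < cabs gamma ->
  cabs gamma <= cabs a `^ (3 / 2) ->
  (limsup0 (fun eps => Leps_aVbV a (- a)%R eps (0%R, gamma)) <
   Order.min (Order.min (L_a0b0 a (- a)%R (0%R, gamma)) (L_aVb0 a (- a)%R (0%R, gamma)))
             (Order.min (L_a0bV a (- a)%R (0%R, gamma)) (L_aVbV a (- a)%R (0%R, gamma))))%E.
Proof.
move=> a1 ag ga.
have g0 : gamma != 0 by rewrite -cabs_gt0; apply: le_lt_trans ag; rewrite exprn_ge0 // cabs_ge0.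
(* For a = 0 the power 0 to the 3/2 is 0, which would force gamma = 0. *)
have a0 : 0 < cabs a.
  rewrite lt_neqAle cabs_ge0 andbT; apply/eqP => e; move: ga; rewrite -e powR0 ?gt_eqF ?divr_gt0 //.
  by rewrite leNgt cabs_gt0 g0.
have an0 : a != 0 by rewrite -cabs_gt0.
set A := cabs a in a0 a1 ag ga *.
have g2 : cabs gamma ^+ 2 <= A ^+ 3.
  have -> : A ^+ 3 = (A `^ (3 / 2)) ^+ 2.
    by rewrite -!powR_mulrn ?powR_ge0 ?(ltW a0) // -powRrM divfK.
  by rewrite lerXn2r ?nnegrE ?cabs_ge0 ?powR_ge0.
have [m2 m2A H2] := @bound_aVb0 R A (introT andP (conj a0 a1)).
have [m3 m3A H3] := @bound_aVbV R A (introT andP (conj a0 a1)).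
(* exp of each of the four infima is at least [M]; the cap 1 ensures P < 1. *)
pose M := Num.min (Num.min (cabs gamma) m2) (Num.min m3 1).
have A21 : A ^+ 2 < 1 by rewrite sqr_lt1 // ltW.
have AM : A ^+ 2 < M by rewrite !lt_min ag m2A m3A A21.
have A20 : 0 < A ^+ 2 by rewrite exprn_gt0.
have M0 : 0 < M by apply: lt_trans AM.
have M1 : M <= 1 by rewrite !ge_min lexx !orbT.
(* [P] and [m] are midpoint choices with A^2 < P^2 < m < M. Then |gamma|^2 <= A^3 < P^3 is strict,
   as [Leps_near0] requires. *)
pose P := Num.sqrt ((A ^+ 2 + M) / 2).
have P2 : P ^+ 2 = (A ^+ 2 + M) / 2 by rewrite sqr_sqrtr // divr_ge0 // addr_ge0 // ltW.
have P0 : 0 < P by rewrite sqrtr_gt0 divr_gt0 // addr_gt0.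
have P1 : P < 1 by rewrite -sqr_lt1 ?(ltW P0) // P2; lra.
have AP : A < P by rewrite -(@ltr_pXn2r _ 2) ?nnegrE ?(ltW a0) ?(ltW P0) // P2; lra.
pose m := (P ^+ 2 + M) / 2.
have m0 : 0 < m by rewrite /m P2; lra.
apply: (@le_lt_trans _ _ (ln m)%:E).
  apply: limsup0_le; apply: (Leps_near0 P0 P1 AP g0); last by rewrite /m P2; lra.
  by apply: le_lt_trans g2 _; rewrite ltr_pXn2r ?nnegrE ?(ltW a0) ?(ltW P0).
apply: (@lt_le_trans _ _ (ln M)%:E).
  by rewrite lte_fin ltr_ln ?posrE // /m P2; lra.
have M_g : M <= cabs gamma by rewrite !ge_min lexx.
have M_2 : M <= m2 by rewrite !ge_min lexx orbT.
have M_3 : M <= m3 by rewrite !ge_min lexx !orbT.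
(* No point over a pole is 0, so [elog] never takes the value -oo here. *)
have nz (phi : R[i]%C -> R[i]%C) (z c : R[i]%C) : phi 0 = 0 -> phi z = c -> c != 0 -> z != 0.
  by move=> p0 pz; apply: contraNneq => e; rewrite -pz e p0.
have na0 : - a != 0 by rewrite oppr_eq0.
have cNa : cabs (- a) = A by rewrite cabsN.
have selfm (phi1 phi2 : R[i]%C -> R[i]%C) : holD2 phi1 phi2 -> self_map phi1 /\ self_map phi2.
  by move=> [/holD_hol h1 [/holD_hol h2 hD]]; split; split=> // u hu; have [] := hD u hu.
rewrite !le_min; apply/andP; split; apply/andP; split; apply: le_ereal_inf_tmp => v.
- move=> [phi1 [phi2 [z1 [z2 [h [h1 [h2 [[f0 k0] [[f1 k1] [[f2 k2] ->]]]]]]]]]].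
  have n1 := nz _ _ _ f0 f1 an0; have n2 := nz _ _ _ f0 f2 na0.
  rewrite !elog_neq0 // -EFinD lee_fin -lnM ?posrE ?cabs_gt0 // ler_ln ?posrE ?mulr_gt0 ?cabs_gt0 //.
  apply: le_trans M_g _; rewrite -k0; apply: two_zeros => //; first exact: (selfm _ _ h).2.
  apply/eqP => e; move: f2; rewrite -e f1 => /eqP; rewrite -addr_eq0 -mulr2n mulrn_eq0 /=.
  by rewrite (negbTE an0).
- move=> [phi1 [phi2 [z1 [z2 [h [h1 [h2 [[f0 k0] [[f1 k1] [[f2 k2] [d1 ->]]]]]]]]]]].
  have n1 := nz _ _ _ f0 f1 an0; have n2 := nz _ _ _ f0 f2 na0.
  rewrite !elog_neq0 // -EFinM -EFinD lee_fin mulr_natl -lnXn ?cabs_gt0 // -lnM ?posrE ?exprn_gt0 ?cabs_gt0 //.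
  rewrite ler_ln ?posrE ?mulr_gt0 ?exprn_gt0 ?cabs_gt0 //.
  apply: le_trans M_2 _; apply: (H2 phi1 a) => //; first exact: (selfm _ _ h).1.
  exact: holD_cderiv0 h.1 h1 d1.
- move=> [phi1 [phi2 [z1 [z2 [h [h1 [h2 [[f0 k0] [[f1 k1] [[f2 k2] [d2 ->]]]]]]]]]]].
  have n1 := nz _ _ _ f0 f1 an0; have n2 := nz _ _ _ f0 f2 na0.
  rewrite !elog_neq0 // -EFinM -EFinD lee_fin mulr_natl -lnXn ?cabs_gt0 // -lnM ?posrE ?exprn_gt0 ?cabs_gt0 //.
  rewrite ler_ln ?posrE ?mulr_gt0 ?exprn_gt0 ?cabs_gt0 //.
  (* The bound for a double value at a is used with -a in place of a and the two points
     exchanged. *)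
  apply: le_trans M_2 _; rewrite mulrC; apply: (H2 phi1 (- a)) => //; first exact: (selfm _ _ h).1.
    exact: holD_cderiv0 h.1 h2 d2.
  by rewrite opprK.
- move=> [phi1 [phi2 [z1 [z2 [h [h1 [h2 [[f0 k0] [[f1 k1] [[f2 k2] [d1 [d2 ->]]]]]]]]]]]].
  have n1 := nz _ _ _ f0 f1 an0; have n2 := nz _ _ _ f0 f2 na0.
  rewrite !elog_neq0 // -!EFinM -EFinD lee_fin !mulr_natl -!lnXn ?cabs_gt0 // -lnM ?posrE ?exprn_gt0 ?cabs_gt0 //.
  rewrite ler_ln ?posrE ?mulr_gt0 ?exprn_gt0 ?cabs_gt0 //.
  apply: le_trans M_3 _; apply: (H3 phi1 a) => //; first exact: (selfm _ _ h).1.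
    exact: holD_cderiv0 h.1 h1 d1.
  exact: holD_cderiv0 h.1 h2 d2.
Qed.
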